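(* There exists a constant $C>0$ such that for every $f\in C^\infty_c(\mathbb{R}^2)$ and every $t>0$, $$\|e^{R_1 t}f\|_{L^\infty(\mathbb{R}^2)}\leq C\, t^{-1/2}\,\|f\|_{\dot{B}^{2}_{1,1}}.$$
   Context: The Fourier transform $\hat f$ on $\mathbb{R}^2$ is normalized so that $f(x)=\int_{\mathbb{R}^2}\hat f(\xi)e^{ix\cdot\xi}\,d\xi$. $R_1$ is the Riesz transform in $x_1$, the Fourier multiplier with symbol $-i\xi_1/|\xi|$, and $e^{R_1t}$ is the semigroup of the linear equation $\partial_t\omega-R_1\omega=0$ on $\mathbb{R}^2$, i.e. the Fourier multiplier with symbol $e^{-it\xi_1/|\xi|}$: $$e^{R_1 t}f(x)=\int_{\mathbb{R}^2}\hat{f}(\xi)e^{ix\cdot\xi -it\frac{\xi_1}{|\xi|}}\, d\xi .$$ The homogeneous Besov norm is $\|f\|_{\dot B^2_{1,1}}=\sum_{j\in\mathbb{Z}}2^{2j}\|P_jf\|_{L^1}$, where $P_j$ are Littlewood-Paley projectors: $\widehat{P_jf}(\xi)=\varphi(2^{-j}\xi)\hat f(\xi)$ for a fixed smooth bump function $\varphi:\mathbb{R}^2\to\mathbb{R}$ supported in an annulus $|\xi|\sim1$ with $\sum_{j\in\mathbb{Z}}\varphi(2^{-j}\xi)=1$ for $\xi\neq0$. *)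

(* Defs.v *)
From HB Require Import structures.
From mathcomp Require Import all_boot all_order all_algebra.
From mathcomp Require Import complex.
From mathcomp Require Import all_classical all_reals all_analysis.

Set Implicit Arguments.
Unset Strict Implicit.
Unset Printing Implicit Defensive.

Import Order.TTheory GRing.Theory Num.Theory.
Import numFieldNormedType.Exports.

Local Open Scope classical_set_scope.
Local Open Scope ring_scope.
Local Open Scope complex_scope.

Section Plane.
Context {R : realType}.
Implicit Types (x xi : R * R) (f m : R * R -> R[i]).

Definition leb2 : {measure set (measurableTypeR R * measurableTypeR R) -> \bar R} :=
  (@lebesgue_measure R \x @lebesgue_measure R)%E.

Definition dot x xi : R := x.1 * xi.1 + x.2 * xi.2.

(* The library norm on the product [R * R] is the sup norm. *)
Definition eucl xi : R := Num.sqrt (xi.1 ^+ 2 + xi.2 ^+ 2).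

Definition modulus (z : R[i]) : R :=
  Num.sqrt (complex.Re z ^+ 2 + complex.Im z ^+ 2).

Definition expi (theta : R) : R[i] := cos theta +i* sin theta.

Definition cintegral f : R[i] :=
  (\int[leb2]_x complex.Re (f x)) +i* (\int[leb2]_x complex.Im (f x)).

Fixpoint isCk (k : nat) (g : R * R -> R) : Prop :=
  match k with
  | 0 => continuous g
  | k'.+1 => [/\ continuous g,
      forall x, derivable g x (1, 0) /\ derivable g x (0, 1),
      isCk k' ('D_(1, 0) g) & isCk k' ('D_(0, 1) g)]
  end.

Definition smooth (g : R * R -> R) : Prop := forall k, isCk k g.

Definition test_function f : Prop :=
  [/\ smooth (fun x => complex.Re (f x)), smooth (fun x => complex.Im (f x))
    & compact (closure [set x | f x != 0])].

(* The factor [(2 pi)^-2] is the one for which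
   [f x = cintegral (fun xi => fourier f xi * expi (dot x xi))]. *)
Definition fourier f xi : R[i] :=
  (((2 * pi) ^+ 2)^-1)%:C * cintegral (fun x => f x * expi (- dot x xi)).

Definition multiplier m f x : R[i] :=
  cintegral (fun xi => m xi * fourier f xi * expi (dot x xi)).

(* The value of the symbol at [xi = 0], where the quotient is [0 / 0 = 0],
   is immaterial: it only affects a null set. *)
Definition riesz_semigroup (t : R) : (R * R -> R[i]) -> R * R -> R[i] :=
  multiplier (fun xi => expi (- (t * (xi.1 / eucl xi)))).

(* The sum over [j] is a finite-support sum: by the support condition only
   finitely many terms are nonzero for a given [xi != 0]. *)
Definition littlewood_paley_bump (phi : R * R -> R) : Prop :=
  [/\ smooth phi,
      exists a b : R, 0 < a /\ (forall xi, phi xi != 0 -> a <= eucl xi <= b)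
    & forall xi, xi != 0 -> \sum_(j \in [set: int]) phi (2 ^ (- j) *: xi) = 1].

Definition LPproj (phi : R * R -> R) (j : int) :
    (R * R -> R[i]) -> R * R -> R[i] :=
  multiplier (fun xi => (phi (2 ^ (- j) *: xi))%:C).

Definition cLnorm (p : \bar R) f : \bar R :=
  'N[leb2]_p [(fun x => (modulus (f x))%:E)]%E.

Definition besov_2_1_1 (phi : R * R -> R) f : \bar R :=
  (\esum_(j in [set: int]) ((2 ^ (2 * j))%:E * cLnorm 1 (LPproj phi j f)))%E.

End Plane.

(* Main.v *)
From HB Require Import structures.
Require Import Defs.
From mathcomp Require Import all_boot all_order all_algebra.
From mathcomp Require Import complex zify ring lra.
From mathcomp Require Import all_classical all_reals all_analysis.
From mathcomp Require Import measurable_realfun ess_sup_inf.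

(** Up to absolute constants, the piece of the multiplier integral at frequencies
    of size [2 ^ j] is the convolution of [P_j f] with the kernel
    [K(y) = \int e^{i (y . xi - t xi_1 / |xi|)} d xi], cut off at these
    frequencies. So the theorem follows from a bound [|K(y)| <= C 2^{2j} / sqrt t]
    uniform in [y], from a way to write the piece as such a convolution, and from a
    summation over [j].

    The kernel.  The cut-off only has to equal [1] on the support of the bump, so
    it can be the indicator of a box [[-B, B]^2], and the bound is
    [C B^2 / sqrt t] ([normr_box_kernel_le]). The symbol [p = xi_1 / |xi|] has
    second derivatives
      [d_2^2 p = - xi_1 (xi_1^2 - 2 xi_2^2) / |xi|^5] and
      [d_1^2 p = - 3 xi_1 xi_2^2 / |xi|^5].
    The box splits into three sectors, and on each of them one of these two has a
    constant sign on the pieces of every slice and an explicit lower bound in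
    absolute value: where [2 |xi_2| < |xi_1|] the first one is at least
    [c / xi_1^2]; where [|xi_1| < |xi_2|] it is at least [c |xi_1| / B^3], which degenerates at
    [xi_1 = 0] but so slowly that the resulting [|xi_1|^{-1/2}] is integrable; in
    between, where the first one vanishes on the lines [|xi_1| = sqrt 2 |xi_2|],
    the second one is at least [c / xi_2^2]. Van der Corput's second derivative
    test ([van_der_corput]) bounds the integral over each slice, and Fubini's
    theorem integrates the bounds over the slices.

    The convolution.  For a continuous [g] with compact support and an integrable
    inverse transform [P], the identity between
    [\int_box g e^{i Phi}] and [\int P(y) K(x - y) dy] is obtained through Fejer
    means. The triple integral [pairing], over position [y] with a tent weight of
    width [N] and over two frequencies, is absolutely convergent. Integrated in [y]
    first, it is the integral over the box of the Fejer mean of [g] ([pairingE]),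
    which tends to [g] times the mass of the Fejer kernel; integrated in the
    frequencies first, it is at most [||P||_1 sup |K|] ([pairing_le]). In the
    limit, this gives [inversion_le]; the mass is positive and goes into the
    constant.

    The summation.  If the integrand of the multiplier is not integrable, its
    integral is [0] by convention. Otherwise its integral is the limit of the
    integrals over shells [1/n < max(|xi_1|, |xi_2|) <= n]. A shell is the
    difference of two boxes, and only finitely many dyadic pieces meet it
    ([shell_partition]). On a box, the piece [j] is at most
    [C 2^{2j} ||P_j f||_1 / sqrt t] whatever the size of the box, as the box may be
    cut down to the support of the piece ([box_term]). Hence the integral over each
    shell is at most [C / sqrt t] times a partial sum of the Besov norm
    ([oscillatory_integral_le]).

    All integrals are those of real and imaginary parts. A sine is a cosine with
    the phase moved by [pi / 2], which is why a constant [s] is carried in all the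
    phases. *)

Set Implicit Arguments.
Unset Strict Implicit.
Unset Printing Implicit Defensive.

Import Order.TTheory GRing.Theory Num.Theory.
Import numFieldNormedType.Exports.

Local Open Scope classical_set_scope.
Local Open Scope ring_scope.

(** * Van der Corput's second derivative test *)

Section VanDerCorput.
Context {R : realType}.
Notation mu := (@lebesgue_measure R).

Lemma continuous_itv_integrable (h : R -> R) (a b : R) : continuous h ->
  mu.-integrable `[a, b] (EFin \o h).
Proof.
move=> ch; apply: continuous_compact_integrable; first exact: segment_compact.
exact: continuous_subspaceT.
Qed.

Lemma Rintegral_derive (F F' : R -> R) (a b : R) : a <= b ->
  continuous F' -> (forall x : R, is_derive x 1 F (F' x)) ->
  \int[mu]_(x in `[a, b]) F' x = F b - F a.
Proof.
rewrite le_eqVlt => /predU1P[-> _ _|ab cF' dF].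
  by rewrite subrr set_itv1 Rintegral_set1.
have cF x : {for x, continuous F}.
  by apply/differentiable_continuous/derivable1_diffP/ex_derive.
rewrite /Rintegral (continuous_FTC2 ab (F := F)) //.
- exact: continuous_subspaceT.
- split; first by move=> x _; apply/ex_derive.
  + exact/cvg_at_right_filter/cF.
  + exact/cvg_at_left_filter/cF.
- by move=> x _; rewrite derive1E; apply/derive_val.
Qed.

Lemma le_integral_derive (f F F' : R -> R) (a b : R) : a <= b ->
  continuous f -> continuous F' -> (forall x : R, is_derive x 1 F (F' x)) ->
  (forall x, x \in `[a, b] -> f x <= F' x) ->
  \int[mu]_(x in `[a, b]) f x <= F b - F a.
Proof.
move=> ab cf cF' dF fF'; rewrite -(Rintegral_derive ab cF' dF).
by apply: le_Rintegral => //; exact: continuous_itv_integrable.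
Qed.

(** There is an explicit function [W] with [cos p <= W'] and of variation at most
    [(1 + 2 pi) / sqrt lam]. Away from stationary points, integration by parts
    suggests the primitive [sin p / p']; it is regularized to
    [sin p * p' / (p'^2 + lam)], and the error is dominated by the derivative of
    [2 atan (p' / sqrt lam) / sqrt lam], because [p'' >= lam]. This treats
    stationary points together with the rest of the interval. *)
Lemma van_der_corput_le (p p1 p2 : R -> R) (a b lam : R) : a <= b -> 0 < lam ->
  (forall x : R, is_derive x 1 p (p1 x)) ->
  (forall x : R, is_derive x 1 p1 (p2 x)) -> continuous p2 ->
  (forall x, x \in `[a, b] -> lam <= p2 x) ->
  \int[mu]_(x in `[a, b]) cos (p x) <= (1 + 2 * pi) / Num.sqrt lam.
Proof.
move=> ab lam0 dp dp1 cp2 hlam.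
have cp x : {for x, continuous p}.
  by apply/differentiable_continuous/derivable1_diffP/ex_derive.
have cp1 x : {for x, continuous p1}.
  by apply/differentiable_continuous/derivable1_diffP/ex_derive.
set s := Num.sqrt lam.
have s0 : 0 < s by rewrite sqrtr_gt0.
have s2 : s ^+ 2 = lam by rewrite sqr_sqrtr// ltW.
pose D x := p1 x ^+ 2 + lam.
have D0 x : 0 < D x by rewrite ltr_wpDl// sqr_ge0.
have Dn0 x : D x != 0 by rewrite gt_eqF.
pose W x := sin (p x) * (p1 x * (D x)^-1) + 2 * (s^-1 * atan (p1 x * s^-1)).
pose W' x := cos (p x) * p1 x ^+ 2 * (D x)^-1
   + sin (p x) * (p2 x * (lam - p1 x ^+ 2) * ((D x)^-1) ^+ 2)
   + 2 * (p2 x * (D x)^-1).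
have dW (x : R) : is_derive x 1 W (W' x).
  have dD : is_derive x 1 D (2 * p1 x * p2 x).
    apply: is_derive_eq. rewrite -?[_ *: _]/(_ * _); ring.
  have dDV := is_deriveV (Dn0 x) dD.
  have ds : is_derive x 1 (fun x => sin (p x)) (cos (p x) * p1 x).
    exact: (@is_derive1_comp _ sin p).
  have da : is_derive x 1 (fun x => atan (p1 x * s^-1))
      ((1 + (p1 x * s^-1) ^+ 2)^-1 * (p2 x * s^-1)).
    apply: (@is_derive1_comp _ atan (fun x => p1 x * s^-1)).
    apply: is_derive_eq; rewrite -![_ *: _]/(_ * _); ring.
  apply: is_derive_eq.
  rewrite -![_ *: _]/(_ * _).
  have -> : (1 + (p1 x * s^-1) ^+ 2)^-1 = s ^+ 2 * (D x)^-1.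
    rewrite /D -s2; field.
    by rewrite s2 (gt_eqF s0) Dn0.
  rewrite /W' /D -s2; field.
  by rewrite s2 (gt_eqF s0) Dn0.
have D0' x : 0 < (D x)^-1 by rewrite invr_gt0.
have cD : continuous (fun x => (D x)^-1).
  move=> x; apply: cvgV => //; apply: cvgD; last exact: cvg_cst.
  by apply: cvgM; exact: cp1.
have cW' : continuous W'.
  move=> x; apply: cvgD; first apply: cvgD.
  - apply: cvgM; last exact: cD.
    apply: cvgM; last by apply: cvgM; exact: cp1.
    by apply: continuous_comp; [exact: cp|exact: continuous_cos].
  - apply: cvgM.
      by apply: continuous_comp; [exact: cp|exact: continuous_sin].
    apply: cvgM; last by apply: cvgM; exact: cD.
    apply: cvgM; first exact: cp2.
    by apply: cvgB; [exact: cvg_cst|apply: cvgM; exact: cp1].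
  - apply: cvgM; first exact: cvg_cst.
    by apply: cvgM; [exact: cp2|exact: cD].
apply: le_trans (_ : W b - W a <= _).
  apply: (le_integral_derive (F' := W')) => //.
    by move=> x; apply: continuous_comp; [exact: cp|exact: continuous_cos].
  move=> x /hlam hx.
  have DD : D x * (D x)^-1 = 1 by rewrite divff.
  rewrite -subr_ge0.
  set d := (D x)^-1 in DD *.
  have d0 : 0 < d by exact: D0'.
  (* Both summands are nonnegative: the first because [p'' >= lam], the second
     because [(lam - p'^2) / (lam + p'^2)] lies between [-1] and [1]. *)
  have -> : W' x - cos (p x) = d * (p2 x - lam * cos (p x))
     + p2 x * d * (1 + sin (p x) * ((lam - p1 x ^+ 2) * d)).
    rewrite /W' -/d.
    transitivity (W' x - cos (p x) * (D x * d)); first by rewrite DD mulr1.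
    rewrite /W' -/d /D; ring.
  have p20 : 0 < p2 x by exact: lt_le_trans hx.
  apply: addr_ge0; apply: mulr_ge0; [exact: ltW| |by rewrite mulr_ge0 ?ltW|].
    by rewrite subr_ge0 (le_trans _ hx)// ger_pMr// cos_le1.
  have h1 : `|sin (p x) * ((lam - p1 x ^+ 2) * d)| <= 1.
    rewrite normrM -[1]mulr1 ler_pM ?sin_max//.
    rewrite -DD normrM (gtr0_norm d0) ler_wpM2r ?(ltW d0)// /D.
    rewrite ler_norml; have := sqr_ge0 (p1 x); lra.
  by move: h1; rewrite ler_norml => /andP[]; lra.
have hQ x : `|sin (p x) * (p1 x / D x)| <= s^-1 / 2.
  rewrite normrM -[leRHS]mul1r ler_pM ?sin_max//.
  rewrite normrM (gtr0_norm (D0' x)) ler_pdivrMr//.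
  have := sqr_ge0 (`|p1 x| - s).
  have : D x = `|p1 x| ^+ 2 + s ^+ 2 by rewrite s2 -normrX ger0_norm ?sqr_ge0.
  move=> -> hh.
  rewrite -(ler_pM2l s0) !mulrA divff ?gt_eqF//; lra.
have hA x : `|s^-1 * atan (p1 x / s)| <= s^-1 * (pi / 2).
  rewrite normrM (gtr0_norm (x := s^-1)) ?invr_gt0// ler_wpM2l ?invr_ge0 ?(ltW s0)//.
  by rewrite ler_norml !ltW ?atan_gtNpi2 ?atan_ltpi2.
rewrite /W.
have := hQ a; have := hQ b; have := hA a; have := hA b.
rewrite !ler_norml => /andP[? ?] /andP[? ?] /andP[? ?] /andP[? ?].
rewrite mulrDl; lra.
Qed.

(** The lower bound is the upper bound for the phase [p + pi]. *)
Lemma van_der_corput_convex (p p1 p2 : R -> R) (a b lam : R) : a <= b -> 0 < lam ->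
  (forall x : R, is_derive x 1 p (p1 x)) ->
  (forall x : R, is_derive x 1 p1 (p2 x)) -> continuous p2 ->
  (forall x, x \in `[a, b] -> lam <= p2 x) ->
  `|\int[mu]_(x in `[a, b]) cos (p x)| <= (1 + 2 * pi) / Num.sqrt lam.
Proof.
move=> ab lam0 dp dp1 cp2 hlam; rewrite ler_norml (van_der_corput_le ab lam0 dp)// andbT.
rewrite lerNl.
have cp x : {for x, continuous p}.
  by apply/differentiable_continuous/derivable1_diffP/ex_derive.
have -> : - (\int[mu]_(x in `[a, b]) cos (p x)) =
    \int[mu]_(x in `[a, b]) cos (p x + pi).
  rewrite -mulN1r -RintegralZl//.
    by apply: eq_Rintegral => x _; rewrite cosDpi mulN1r.
  apply: continuous_compact_integrable; first exact: segment_compact.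
  apply: continuous_subspaceT => x.
  by apply: continuous_comp; [exact: cp|exact: continuous_cos].
apply: (van_der_corput_le (p1 := p1) (p2 := p2)) => // x.
by apply: is_derive_eq; rewrite addr0.
Qed.

(** A concave phase is the opposite of a convex one, and the cosine is even. *)
Lemma van_der_corput (p p1 p2 : R -> R) (a b lam : R) : a <= b -> 0 < lam ->
  (forall x : R, is_derive x 1 p (p1 x)) ->
  (forall x : R, is_derive x 1 p1 (p2 x)) -> continuous p2 ->
  (forall x, x \in `[a, b] -> lam <= p2 x) \/
  (forall x, x \in `[a, b] -> lam <= - p2 x) ->
  `|\int[mu]_(x in `[a, b]) cos (p x)| <= (1 + 2 * pi) / Num.sqrt lam.
Proof.
move=> ab lam0 dp dp1 cp2 [hlam|hlam]; first exact: van_der_corput_convex hlam.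
under eq_Rintegral do rewrite -cosN.
apply: (van_der_corput_convex (p1 := fun x => - p1 x) (p2 := fun x => - p2 x)) => // x.
by apply: cvgN; exact: cp2.
Qed.

End VanDerCorput.

(** * The phase on horizontal and vertical lines *)

Section Slices.
Context {R : realType}.
Notation mu := (@lebesgue_measure R).

Definition inv_norm (c y : R) : R := (Num.sqrt (c ^+ 2 + y ^+ 2))^-1.

Let inv_norm_sqrK (c y : R) : c != 0 -> inv_norm c y ^+ 2 * (c ^+ 2 + y ^+ 2) = 1.
Proof.
move=> c0; have h : 0 < c ^+ 2 + y ^+ 2.
  by rewrite ltr_pwDl ?sqr_ge0// exprn_even_gt0.
by rewrite /inv_norm exprVn sqr_sqrtr ?(ltW h)// mulVf// gt_eqF.
Qed.

Let inv_norm_derive (c y : R) : c != 0 -> is_derive y 1 (inv_norm c) (- (y * inv_norm c y ^+ 3)).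
Proof.
move=> c0; have h : 0 < c ^+ 2 + y ^+ 2.
  by rewrite ltr_pwDl ?sqr_ge0// exprn_even_gt0.
have dq : is_derive y 1 (fun y => c ^+ 2 + y ^+ 2) (2 * y).
  by apply: is_derive_eq; rewrite -?[_ *: _]/(_ * _); ring.
have ds : is_derive y 1 (fun y => Num.sqrt (c ^+ 2 + y ^+ 2))
    ((2 * Num.sqrt (c ^+ 2 + y ^+ 2))^-1 * (2 * y)).
  by apply: (@is_derive1_comp _ Num.sqrt); exact: is_derive1_sqrt.
have s0 : Num.sqrt (c ^+ 2 + y ^+ 2) != 0 by rewrite gt_eqF// sqrtr_gt0.
have dk := @is_deriveV _ (fun y => Num.sqrt (c ^+ 2 + y ^+ 2)) y _ 1 s0 ds.
apply: is_derive_eq; rewrite -?[_ *: _]/(_ * _) /inv_norm; field.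
exact: s0.
Qed.

Lemma continuous_inv_norm (c : R) : c != 0 -> continuous (inv_norm c).
Proof.
move=> c0 y; apply/differentiable_continuous/derivable1_diffP.
by have := @inv_norm_derive c y c0 => ?; exact: ex_derive.
Qed.

(** On the vertical line [xi_1 = c] the symbol is [y |-> c * inv_norm c y], and
    [t c (c^2 - 2 y^2) / |xi|^5] is the second derivative of the phase. *)
Lemma vertical_slice (s x2 t c a b lam : R) : c != 0 -> a <= b -> 0 < lam ->
  (forall y, y \in `[a, b] -> lam <= t * c * inv_norm c y ^+ 5 * (c ^+ 2 - 2 * y ^+ 2)) \/
  (forall y, y \in `[a, b] -> lam <= - (t * c * inv_norm c y ^+ 5 * (c ^+ 2 - 2 * y ^+ 2))) ->
  `|\int[mu]_(y in `[a, b]) cos (s + x2 * y - t * (c * inv_norm c y))|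
    <= (1 + 2 * pi) / Num.sqrt lam.
Proof.
move=> c0 ab lam0 hlam.
apply: (van_der_corput (p1 := fun y => x2 + t * c * (y * inv_norm c y ^+ 3))
  (p2 := fun y => t * c * inv_norm c y ^+ 5 * (c ^+ 2 - 2 * y ^+ 2)) ab lam0 _ _ _ hlam).
- move=> y; have dk := inv_norm_derive y c0.
  by apply: is_derive_eq; rewrite -?[_ *: _]/(_ * _); ring.
- move=> y; have dk := inv_norm_derive y c0.
  apply: is_derive_eq; rewrite -?[_ *: _]/(_ * _).
  transitivity (t * c * (inv_norm c y ^+ 3 * (inv_norm c y ^+ 2 * (c ^+ 2 + y ^+ 2))
    - 3 * y ^+ 2 * inv_norm c y ^+ 5)); first by rewrite inv_norm_sqrK//; ring.
  ring.
- move=> y; apply: cvgM; first apply: cvgM.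
  + exact: cvg_cst.
  + by apply: (@continuous_comp _ _ _ (inv_norm c) (fun z => z ^+ 5));
      [exact: continuous_inv_norm|exact: exprn_continuous].
  + apply: cvgB; first exact: cvg_cst.
    by apply: cvgM; [exact: cvg_cst|exact: exprn_continuous].
Qed.

(** On the horizontal line [xi_2 = c] the symbol is [y |-> y * inv_norm c y], and
    [3 t c^2 y / |xi|^5] is the second derivative of the phase. *)
Lemma horizontal_slice (s x1 t c a b lam : R) : c != 0 -> a <= b -> 0 < lam ->
  (forall y, y \in `[a, b] -> lam <= 3 * t * c ^+ 2 * y * inv_norm c y ^+ 5) \/
  (forall y, y \in `[a, b] -> lam <= - (3 * t * c ^+ 2 * y * inv_norm c y ^+ 5)) ->
  `|\int[mu]_(y in `[a, b]) cos (s + x1 * y - t * (y * inv_norm c y))|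
    <= (1 + 2 * pi) / Num.sqrt lam.
Proof.
move=> c0 ab lam0 hlam.
apply: (van_der_corput (p1 := fun y => x1 - t * c ^+ 2 * inv_norm c y ^+ 3)
  (p2 := fun y => 3 * t * c ^+ 2 * y * inv_norm c y ^+ 5) ab lam0 _ _ _ hlam).
- move=> y; have dk := inv_norm_derive y c0.
  apply: is_derive_eq; rewrite -?[_ *: _]/(_ * _).
  transitivity (x1 - t * (inv_norm c y * (inv_norm c y ^+ 2 * (c ^+ 2 + y ^+ 2))
    - y ^+ 2 * inv_norm c y ^+ 3)); first by rewrite inv_norm_sqrK//; ring.
  ring.
- move=> y; have dk := inv_norm_derive y c0.
  by apply: is_derive_eq; rewrite -?[_ *: _]/(_ * _); ring.
- move=> y; apply: cvgM; first apply: cvgM.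
  + exact: cvg_cst.
  + exact: cvg_id.
  + by apply: (@continuous_comp _ _ _ (inv_norm c) (fun z => z ^+ 5));
      [exact: continuous_inv_norm|exact: exprn_continuous].
Qed.

Let inv_norm_ge (c y d : R) : c != 0 -> 0 < d -> c ^+ 2 + y ^+ 2 <= d ^+ 2 ->
  (d ^+ 5)^-1 <= inv_norm c y ^+ 5.
Proof.
move=> c0 d0 h; rewrite -exprVn ler_pXn2r ?nnegrE ?invr_ge0 ?(ltW d0)//.
  by rewrite lef_pV2 ?posrE// ?sqrtr_gt0 ?ltr_pwDl ?sqr_ge0 ?exprn_even_gt0//
    -(ler_pXn2r (n:=2)) ?nnegrE ?sqrtr_ge0 ?(ltW d0)// sqr_sqrtr// addr_ge0 ?sqr_ge0.
Qed.

Let sqr_abs_le (y d : R) : `|y| <= d -> y ^+ 2 <= d ^+ 2.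
Proof.
by move=> h; rewrite -real_normK ?num_real// ler_pXn2r ?nnegrE ?(le_trans _ h).
Qed.

(** Here [c^2 - 2 y^2 >= c^2 / 2] and [|xi| <= 2 |c|], so that the second
    derivative is at least [t / (64 c^2)]. *)
Lemma vertical_slice_flat (s x2 t c a b : R) : 0 < t -> c != 0 -> a <= b ->
  (forall y, y \in `[a, b] -> `|y| <= `|c| / 2) ->
  `|\int[mu]_(y in `[a, b]) cos (s + x2 * y - t * (c * inv_norm c y))|
    <= (1 + 2 * pi) * 8 * (`|c| / Num.sqrt t).
Proof.
move=> t0 c0 ab hy.
have n0 : 0 < `|c| by rewrite normr_gt0.
have -> : (1 + 2 * pi) * 8 * (`|c| / Num.sqrt t) =
  (1 + 2 * pi) / Num.sqrt (t / (8 * `|c|) ^+ 2).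
  rewrite sqrtrM ?(ltW t0)// sqrtrV ?sqr_ge0// sqrtr_sqr.
  rewrite (_ : `|8 * `|c| | = 8 * `|c|); last by rewrite ger0_norm// mulr_ge0.
  field; rewrite ?(gt_eqF n0)//= gt_eqF// sqrtr_gt0//.
apply: vertical_slice => //; first by rewrite divr_gt0// exprn_gt0// mulr_gt0.
have key y : y \in `[a, b] ->
    t / (8 * `|c|) ^+ 2 <= t * `|c| * inv_norm c y ^+ 5 * (c ^+ 2 - 2 * y ^+ 2).
  move=> /hy hyc; have hy2 := sqr_abs_le hyc.
  have c2 : c ^+ 2 = `|c| ^+ 2 by rewrite real_normK ?num_real.
  have n5 : ((2 * `|c|) ^+ 5)^-1 <= inv_norm c y ^+ 5.
    apply: inv_norm_ge => //; first by rewrite mulr_gt0.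
    have := sqr_ge0 `|c|; rewrite c2; nra.
  have -> : t / (8 * `|c|) ^+ 2 =
    t * `|c| * ((2 * `|c|) ^+ 5)^-1 * (`|c| ^+ 2 / 2) by field; rewrite gt_eqF.
  apply: ler_pM; rewrite ?mulr_ge0 ?invr_ge0 ?exprn_ge0 ?mulr_ge0 ?(ltW t0)//.
    by apply: ler_wpM2l => //; rewrite mulr_ge0// ltW.
  by rewrite c2; nra.
have [cp|cn] := ltP 0 c; [left|right] => y /key.
  by rewrite gtr0_norm.
by rewrite ler0_norm// !mulrN !mulNr.
Qed.

(** Here [2 y^2 - c^2 >= y^2] and [|xi| <= 2 |y|], so that the second derivative
    is at least [t |c| / (32 |y|^3)], hence at least [t |c| / (32 B^3)]. *)
Lemma vertical_slice_steep (s x2 t c B a b : R) : 0 < t -> c != 0 -> a <= b ->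
  (forall y, y \in `[a, b] -> `|c| <= `|y| <= B) ->
  `|\int[mu]_(y in `[a, b]) cos (s + x2 * y - t * (c * inv_norm c y))|
    <= (1 + 2 * pi) * Num.sqrt (32 * B ^+ 3 / t) / Num.sqrt `|c|.
Proof.
move=> t0 c0 ab hy.
have n0 : 0 < `|c| by rewrite normr_gt0.
have B0 : 0 < B.
  have /hy/andP[h1 h2] : a \in `[a, b] by rewrite in_itv/= lexx.
  exact: lt_le_trans (le_trans h1 h2).
have -> : (1 + 2 * pi) * Num.sqrt (32 * B ^+ 3 / t) / Num.sqrt `|c| =
  (1 + 2 * pi) / Num.sqrt (t * `|c| / (32 * B ^+ 3)).
  have -> : t * `|c| / (32 * B ^+ 3) = (32 * B ^+ 3 / t)^-1 * `|c|.
    by field; rewrite !gt_eqF.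
  rewrite [in RHS]sqrtrM ?invr_ge0 ?divr_ge0 ?mulr_ge0 ?exprn_ge0 ?ltW//.
  rewrite sqrtrV ?divr_ge0 ?mulr_ge0 ?exprn_ge0 ?ltW//.
  set S := Num.sqrt (_ / t); rewrite [in RHS]invfM (invrK S).
  by rewrite [in RHS]mulrA.
apply: vertical_slice => //.
  by rewrite divr_gt0 ?mulr_gt0 ?exprn_gt0.
have key y : y \in `[a, b] ->
    t * `|c| / (32 * B ^+ 3) <= t * `|c| * inv_norm c y ^+ 5 * (2 * y ^+ 2 - c ^+ 2).
  move=> /hy/andP[hcy hyB].
  have c2 : c ^+ 2 = `|c| ^+ 2 by rewrite real_normK ?num_real.
  have y2 : y ^+ 2 = `|y| ^+ 2 by rewrite real_normK ?num_real.
  have y0 : 0 < `|y| by exact: lt_le_trans hcy.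
  have cy2 : `|c| ^+ 2 <= `|y| ^+ 2 by rewrite ler_pXn2r ?nnegrE.
  have n5 : ((2 * `|y|) ^+ 5)^-1 <= inv_norm c y ^+ 5.
    apply: inv_norm_ge => //; first by rewrite mulr_gt0.
    have := sqr_ge0 `|y|; rewrite c2 y2; nra.
  apply: le_trans (_ : t * `|c| * ((2 * `|y|) ^+ 5)^-1 * `|y| ^+ 2 <= _).
    have -> : t * `|c| * ((2 * `|y|) ^+ 5)^-1 * `|y| ^+ 2 =
      t * `|c| / (32 * `|y| ^+ 3) by field; rewrite gt_eqF.
    apply: ler_wpM2l; first by rewrite mulr_ge0// ltW.
    rewrite lef_pV2 ?posrE ?mulr_gt0 ?exprn_gt0// ler_pM2l//.
    by rewrite ler_pXn2r ?nnegrE// ltW.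
  apply: ler_pM; rewrite ?mulr_ge0 ?invr_ge0 ?exprn_ge0 ?mulr_ge0 ?(ltW t0)//.
    by apply: ler_wpM2l => //; rewrite mulr_ge0// ltW.
  by rewrite c2 y2; nra.
have [cp|cn] := ltP 0 c; [right|left] => y /key.
  by rewrite gtr0_norm//; congr (_ <= _); ring.
rewrite ler0_norm//; congr (_ <= _); ring.
Qed.

(** Here [|y| >= |c|] and [|xi| <= 3 |c|], so that the second derivative is at
    least [t / (81 c^2)]; its sign is that of [y]. *)
Lemma horizontal_slice_diag (s x1 t c a b : R) : 0 < t -> c != 0 -> a <= b ->
  (forall y, y \in `[a, b] -> `|c| <= `|y| <= 2 * `|c|) ->
  (forall y, y \in `[a, b] -> 0 <= y) \/ (forall y, y \in `[a, b] -> y <= 0) ->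
  `|\int[mu]_(y in `[a, b]) cos (s + x1 * y - t * (y * inv_norm c y))|
    <= (1 + 2 * pi) * 9 * (`|c| / Num.sqrt t).
Proof.
move=> t0 c0 ab hy ysg.
have n0 : 0 < `|c| by rewrite normr_gt0.
have -> : (1 + 2 * pi) * 9 * (`|c| / Num.sqrt t) =
  (1 + 2 * pi) / Num.sqrt (t / (9 * `|c|) ^+ 2).
  rewrite sqrtrM ?(ltW t0)// sqrtrV ?sqr_ge0// sqrtr_sqr.
  rewrite (_ : `|9 * `|c| | = 9 * `|c|); last by rewrite ger0_norm// mulr_ge0.
  field; rewrite ?(gt_eqF n0)//= gt_eqF// sqrtr_gt0//.
apply: horizontal_slice => //; first by rewrite divr_gt0// exprn_gt0// mulr_gt0.
have key y : y \in `[a, b] ->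
    t / (9 * `|c|) ^+ 2 <= 3 * t * c ^+ 2 * `|y| * inv_norm c y ^+ 5.
  move=> /hy/andP[hcy hyB].
  have c2 : c ^+ 2 = `|c| ^+ 2 by rewrite real_normK ?num_real.
  have n5 : ((3 * `|c|) ^+ 5)^-1 <= inv_norm c y ^+ 5.
    apply: inv_norm_ge => //; first by rewrite mulr_gt0.
    have := sqr_abs_le hyB; have := sqr_ge0 `|c|; rewrite c2; nra.
  have -> : t / (9 * `|c|) ^+ 2 =
    3 * t * `|c| ^+ 2 * `|c| * ((3 * `|c|) ^+ 5)^-1 by field; rewrite gt_eqF.
  rewrite c2.
  apply: ler_pM; rewrite ?mulr_ge0 ?invr_ge0 ?exprn_ge0 ?mulr_ge0 ?(ltW t0)//.
  by apply: ler_wpM2l => //; rewrite !mulr_ge0// ?exprn_ge0 ?mulr_ge0// ltW.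
case: ysg => ysg; [left|right] => y yab; have := key y yab.
  by rewrite (ger0_norm (ysg _ yab)).
by rewrite (ler0_norm (ysg _ yab)) mulrN mulNr.
Qed.

End Slices.

(** * Integration on the plane *)

Section Plane.
Context {R : realType}.
Notation mu := (@lebesgue_measure R).

(** The product [leb2] of two Lebesgue measures under a name of its own, to which a
    sigma-finite structure is attached: the product of two planes is then again a
    product of sigma-finite measures, and Fubini's theorem applies to it. *)
Definition plane_measure :
  set (measurableTypeR R * measurableTypeR R) -> \bar R := (mu \x mu)%E.

HB.instance Definition _ := Measure.on plane_measure.

Let plane_measure_sigma_finite : sigma_finite setT plane_measure.
Proof.
have /sigma_finiteP[F [TF ndF Foo]] := sigma_finiteT mu.
exists (fun n => F n `*` F n).
  rewrite -setXTT TF predeqE => -[x y]; split.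
    move=> [/= [n _ Fnx] [k _ Fky]]; exists (maxn n k) => //; split.
    - by move: x Fnx; exact/subsetPset/ndF/leq_maxl.
    - by move: y Fky; exact/subsetPset/ndF/leq_maxr.
  by move=> [n _ []/= ? ?]; split; exists n.
move=> k; have [? ?] := Foo k.
split; first exact: measurableX.
by rewrite /plane_measure product_measure1E// lte_mul_pinfty// ge0_fin_numE.
Qed.

HB.instance Definition _ := Measure_isSigmaFinite.Build _ _ _ plane_measure
  plane_measure_sigma_finite.

End Plane.

Section Generic.
Context d (T : measurableType d) {R : realType}.
Implicit Types (f g : T -> R) (mu : {measure set T -> \bar R}).

Lemma measurable_set_le f g : measurable_fun setT f -> measurable_fun setT g ->
  measurable [set z | f z <= g z].
Proof.
move=> mf mg.
have mh : measurable_fun setT (fun z => f z - g z) by exact: measurable_funB.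
have -> : [set z | f z <= g z] = setT `&` (fun z => f z - g z) @^-1` `]-oo, 0].
  by apply/seteqP; split=> z /=; rewrite in_itv/= subr_le0// => -[].
exact: mh.
Qed.

Lemma measurable_set_lt f g : measurable_fun setT f -> measurable_fun setT g ->
  measurable [set z | f z < g z].
Proof.
move=> mf mg.
have mh : measurable_fun setT (fun z => f z - g z) by exact: measurable_funB.
have -> : [set z | f z < g z] = setT `&` (fun z => f z - g z) @^-1` `]-oo, 0[.
  by apply/seteqP; split=> z /=; rewrite in_itv/= subr_lt0// => -[].
exact: mh.
Qed.

Lemma integrable_indic_lty mu (A : set T) : measurable A -> (mu A < +oo)%E ->
  mu.-integrable setT (EFin \o (\1_A : T -> R)).
Proof.
move=> mA Afin; apply/integrableP; split; first exact/measurable_EFinP.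
rewrite (eq_integral (fun x => (\1_A x)%:E)); last first.
  by move=> t _; rewrite gee0_abs// lee_fin.
by rewrite integral_indic// setIT.
Qed.

Lemma Rintegral_indic mu (A : set T) (M : R) : measurable A -> (mu A < +oo)%E ->
  \int[mu]_x (M * \1_A x) = M * fine (mu A).
Proof.
move=> mA Afin; rewrite RintegralZl//; last exact: integrable_indic_lty.
by rewrite /Rintegral integral_indic// setIT.
Qed.

Lemma integrable_RD mu f g : mu.-integrable setT (EFin \o f) ->
  mu.-integrable setT (EFin \o g) ->
  mu.-integrable setT (EFin \o (fun x => f x + g x)).
Proof.
move=> i1 i2; rewrite (_ : _ \o _ = (EFin \o f) \+ (EFin \o g))%E.
  exact: integrableD.
by apply/funext => x /=; rewrite EFinD.
Qed.

Lemma integrable_RZ mu f (r : R) : mu.-integrable setT (EFin \o f) ->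
  mu.-integrable setT (EFin \o (fun x => r * f x)).
Proof.
move=> i1; rewrite (_ : _ \o _ = (fun x => r%:E * (EFin \o f) x))%E.
  exact: integrableZl.
by apply/funext => x /=; rewrite EFinM.
Qed.

Lemma integrable_bounded_supp mu f (A : set T) (M : R) : measurable A ->
  (mu A < +oo)%E -> measurable_fun setT f ->
  (forall x, `|f x| <= M * \1_A x) -> mu.-integrable setT (EFin \o f).
Proof.
move=> mA Afin mf hf.
apply: (@le_integrable _ _ _ mu setT measurableT _
  (EFin \o (fun x => M * \1_A x))).
- exact/measurable_EFinP.
- move=> x _ /=; rewrite lee_fin; apply: le_trans (hf x) _; exact: ler_norm.
- rewrite (_ : _ \o _ = (fun x => M%:E * (EFin \o \1_A) x)%E); last first.
    by apply/funext => x /=; rewrite EFinM.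
  by apply: integrableZl => //; exact: integrable_indic_lty.
Qed.

End Generic.

Section Fubini.
Context d1 d2 (T1 : measurableType d1) (T2 : measurableType d2) {R : realType}.
Variables (m1 : {sigma_finite_measure set T1 -> \bar R}).
Variables (m2 : {sigma_finite_measure set T2 -> \bar R}).
Variable f : T1 * T2 -> R.
Hypothesis intf : (m1 \x m2)%E.-integrable setT (EFin \o f).

Let mf : measurable_fun setT f.
Proof. by apply/measurable_EFinP; exact: measurable_int intf. Qed.

(** Finite integrals take the value [0] where the extended integral is infinite, so
    the slice integral is dominated by the absolute value of the extended one. *)
Lemma integrable_Rfubini_F :
  m1.-integrable setT (EFin \o (fun x => \int[m2]_y f (x, y))).
Proof.
have iF := integrable_fubini_F intf.
apply: (@le_integrable _ _ _ m1 setT measurableT _ (fubini_F m2 (EFin \o f))) => //.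
  apply: measurableT_comp => //; apply: measurableT_comp; first exact: fine_measurable.
  exact: measurable_int iF.
move=> x _ /=; rewrite /Rintegral /fubini_F.
by case: (\int[m2]_y _)%E => [r| |] //=; rewrite normr0 ?leey.
Qed.

Let swapped : (m2 \x m1)%E.-integrable setT (EFin \o (fun z => f (z.2, z.1))).
Proof.
apply/integrable12ltyP.
  apply/measurable_EFinP; apply: (measurableT_comp mf).
  by apply: measurable_fun_pair; [exact: measurable_snd|exact: measurable_fst].
by have /integrable21ltyP := intf; apply; exact/measurable_EFinP.
Qed.

Let integrable_fubini_G : m2.-integrable setT (fubini_G m1 (EFin \o f)).
Proof. exact: (integrable_fubini_F swapped). Qed.

Lemma integrable_Rfubini_G :
  m2.-integrable setT (EFin \o (fun y => \int[m1]_x f (x, y))).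
Proof.
have iG := integrable_fubini_G.
apply: (@le_integrable _ _ _ m2 setT measurableT _ (fubini_G m1 (EFin \o f))) => //.
  apply: measurableT_comp => //; apply: measurableT_comp; first exact: fine_measurable.
  exact: measurable_int iG.
move=> x _ /=; rewrite /Rintegral /fubini_G.
by case: (\int[m1]_y _)%E => [r| |] //=; rewrite normr0 ?leey.
Qed.

Lemma Rfubini1 : \int[(m1 \x m2)%E]_z f z = \int[m1]_x \int[m2]_y f (x, y).
Proof.
rewrite /Rintegral -integral12_prod_meas1//; congr fine.
apply: ae_eq_integral => //.
- exact: measurable_int (integrable_fubini_F intf).
- exact: measurable_int integrable_Rfubini_F.
have := ae_integrable1 intf; apply: filterS => x ix _ /=.
by rewrite fineK//; exact: integrable_fin_num.
Qed.

Lemma Rfubini2 : \int[(m1 \x m2)%E]_z f z = \int[m2]_y \int[m1]_x f (x, y).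
Proof.
rewrite /Rintegral -integral21_prod_meas1//; congr fine.
apply: ae_eq_integral => //.
- exact: measurable_int integrable_fubini_G.
- exact: measurable_int integrable_Rfubini_G.
have := ae_integrable2 intf; apply: filterS => x ix _ /=.
by rewrite fineK//; exact: integrable_fin_num.
Qed.

Lemma Rfubini :
  \int[m1]_x \int[m2]_y f (x, y) = \int[m2]_y \int[m1]_x f (x, y).
Proof. by rewrite -Rfubini1 Rfubini2. Qed.

(** The absolute value is taken after the inner integral, so that the cancellation
    along the slices is kept. *)
Lemma normr_fubini1_le (G : T1 -> R) : m1.-integrable setT (EFin \o G) ->
  (forall x, `|\int[m2]_y f (x, y)| <= G x) ->
  `|\int[(m1 \x m2)%E]_z f z| <= \int[m1]_x G x.
Proof.
move=> iG hG; rewrite Rfubini1.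
apply: le_trans (le_normr_Rintegral measurableT integrable_Rfubini_F) _.
apply: le_Rintegral => //.
exact: integrable_norm integrable_Rfubini_F.
Qed.

Lemma normr_fubini2_le (G : T2 -> R) : m2.-integrable setT (EFin \o G) ->
  (forall y, `|\int[m1]_x f (x, y)| <= G y) ->
  `|\int[(m1 \x m2)%E]_z f z| <= \int[m2]_y G y.
Proof.
move=> iG hG; rewrite Rfubini2.
apply: le_trans (le_normr_Rintegral measurableT integrable_Rfubini_G) _.
apply: le_Rintegral => //.
exact: integrable_norm integrable_Rfubini_G.
Qed.

End Fubini.

Section Measurability.
Context {R : realType}.

Lemma measurable_eucl : measurable_fun setT (@eucl R).
Proof.
apply: measurableT_comp.
  apply: continuous_measurable_fun; exact: sqrt_continuous.
by apply: measurable_funD; apply: measurable_funX; [exact: measurable_fst|exact: measurable_snd].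
Qed.

Lemma measurable_angle : measurable_fun setT (fun xi : R * R => xi.1 / eucl xi).
Proof.
apply: measurable_funM; first exact: measurable_fst.
have -> : (fun xi : R * R => (eucl xi)^-1) = (@powR R ^~ (- 1)) \o @eucl R.
  by apply/funext => xi /=; rewrite powR_inv1// sqrtr_ge0.
by apply: measurableT_comp; [exact: measurable_powR|exact: measurable_eucl].
Qed.

Lemma measurable_dot d (T : measurableType d) (f g : T -> R * R) :
  measurable_fun setT f -> measurable_fun setT g ->
  measurable_fun setT (fun z => dot (f z) (g z)).
Proof.
move=> mf mg; apply: measurable_funD; apply: measurable_funM.
- exact: (measurableT_comp measurable_fst mf).
- exact: (measurableT_comp measurable_fst mg).
- exact: (measurableT_comp measurable_snd mf).
- exact: (measurableT_comp measurable_snd mg).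
Qed.

Lemma measurable_cos d (T : measurableType d) (f : T -> R) :
  measurable_fun setT f -> measurable_fun setT (fun z => cos (f z)).
Proof.
by apply: measurableT_comp; apply: continuous_measurable_fun; exact: continuous_cos.
Qed.

Lemma measurable_sin d (T : measurableType d) (f : T -> R) :
  measurable_fun setT f -> measurable_fun setT (fun z => sin (f z)).
Proof.
by apply: measurableT_comp; apply: continuous_measurable_fun; exact: continuous_sin.
Qed.

End Measurability.

Section Indicators.
Context {R : realType}.
Notation mu := (@lebesgue_measure R).

Lemma Rintegral_mul_indic d (T : measurableType d) (nu : {measure set T -> \bar R})
  (D : set T) (f : T -> R) :
  \int[nu]_x (f x * \1_D x) = \int[nu]_(x in D) f x.
Proof.
rewrite [RHS]Rintegral_mkcond; apply: eq_Rintegral => x _.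
by rewrite patchE indicE; case: ifP => _; rewrite ?mulr1 ?mulr0.
Qed.

Lemma Rintegral_itv_closed (h : R -> R) (a b : R) (b0 b1 : bool) :
  continuous h ->
  \int[mu]_(x in [set` Interval (BSide b0 a) (BSide b1 b)]) h x =
  \int[mu]_(x in `[a, b]) h x.
Proof.
move=> ch; have mh D : measurable_fun D (EFin \o h).
  by apply/measurable_EFinP; apply: measurable_funTS; exact: continuous_measurable_fun.
rewrite /Rintegral integral_itv_bndoo; last exact: mh.
by rewrite [in RHS]integral_itv_bndoo//; exact: mh.
Qed.

Lemma integrable_mul_indic_itv (h : R -> R) (i : interval R) (M : R) :
  (mu [set` i] < +oo)%E -> measurable_fun setT h -> (forall x, `|h x| <= M) ->
  mu.-integrable setT (EFin \o (fun x => h x * \1_[set` i] x)).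
Proof.
move=> fi mh hM; apply: (@integrable_bounded_supp _ _ _ mu _ [set` i] M) => //.
  by apply: measurable_funM => //; exact: measurable_indic.
move=> x; rewrite normrM (ger0_norm (_ : 0 <= \1__ x))//.
by apply: ler_wpM2r.
Qed.

Lemma mu_itv_lty (a b : R) (b0 b1 : bool) :
  (mu [set` Interval (BSide b0 a) (BSide b1 b)] < +oo)%E.
Proof. by rewrite lebesgue_measure_itv/=; case: ifP => _; rewrite -?EFinB ltry. Qed.

Lemma normr_Rintegral_indic_le (h : R -> R) (D : set R) (a b M : R) : a <= b ->
  measurable_fun setT h -> (forall x, `|h x| <= M) -> measurable D ->
  D `<=` `[a, b] -> `|\int[mu]_x (h x * \1_D x)| <= M * (b - a).
Proof.
move=> ab mh hM mD Dab.
have hle x : `|h x * \1_D x| <= M * \1_(`[a, b]%classic) x.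
  rewrite normrM (ger0_norm (_ : 0 <= \1__ x))// !indicE.
  have [/set_mem/Dab xab|] := boolP (x \in D); first by rewrite mem_set// !mulr1.
  by rewrite mulr0 mulr_ge0// (le_trans _ (hM x)).
have fin_ab : (mu `[a, b]%classic < +oo)%E by exact: mu_itv_lty.
have ih : mu.-integrable setT (EFin \o (fun x => h x * \1_D x)).
  apply: (@integrable_bounded_supp _ _ _ mu _ `[a, b]%classic M) => //.
  by apply: measurable_funM => //; exact: measurable_indic.
apply: le_trans (le_normr_Rintegral measurableT ih) _.
apply: (@le_trans _ _ (\int[mu]_x (M * \1_(`[a, b]%classic) x))).
  apply: le_Rintegral => //; first exact: integrable_norm.
  rewrite (_ : _ \o _ = (fun x => M%:E * (EFin \o \1_(`[a, b]%classic)) x)%E).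
    by apply: integrableZl => //; exact: integrable_indic_lty.
  by apply/funext => x /=; rewrite EFinM.
rewrite Rintegral_indic// (_ : fine _ = b - a)//.
rewrite [X in fine X](lebesgue_measure_itv `[a, b])/= lte_fin.
move: ab; rewrite le_eqVlt => /predU1P[->|->]; last by rewrite -EFinB.
by rewrite ltxx subrr.
Qed.

(** A line meets a sector of the plane in two intervals, symmetric about the origin
    and with some open and some closed ends. *)
Lemma normr_Rintegral_two_itv (h : R -> R) (D : set R) (a b a' b' K : R) (b0 b1 b0' b1' : bool) :
  continuous h -> (forall x, `|h x| <= 1) ->
  (forall y, \1_D y = \1_[set` Interval (BSide b0 a) (BSide b1 b)] y +
     \1_[set` Interval (BSide b0' a') (BSide b1' b')] y :> R) ->
  `|\int[mu]_(x in `[a, b]) h x| <= K ->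
  `|\int[mu]_(x in `[a', b']) h x| <= K ->
  `|\int[mu]_x (h x * \1_D x)| <= 2 * K.
Proof.
move=> ch h1 DE K1 K2.
have mh : measurable_fun setT h by exact: continuous_measurable_fun.
under eq_Rintegral do rewrite DE mulrDr.
rewrite RintegralD//; try exact: (integrable_mul_indic_itv (mu_itv_lty _ _ _ _) mh h1).
rewrite !Rintegral_mul_indic !Rintegral_itv_closed//.
by apply: le_trans (ler_normD _ _) _; rewrite mulr_natl mulr2n lerD.
Qed.

End Indicators.

(** * Decay of the kernel of a box *)

Section BoxKernel.
Context {R : realType}.
Notation mu := (@lebesgue_measure R).
Notation mu2 := (@plane_measure R).

Definition riesz_phase (s t : R) (x xi : R * R) : R :=
  s + dot x xi - t * (xi.1 / eucl xi).

Definition box (B : R) : set (R * R) := [set z | (`|z.1| <= B) && (`|z.2| <= B)].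

Lemma indic_bool T (P : T -> bool) (z : T) : \1_[set z | P z] z = (P z)%:R :> R.
Proof.
by rewrite indicE; congr (nat_of_bool _)%:R; apply/idP/idP; rewrite inE.
Qed.

Lemma measurable_fst_norm : measurable_fun setT (fun z : R * R => `|z.1|).
Proof. by apply: measurableT_comp => //; exact: measurable_fst. Qed.

Lemma measurable_snd_norm : measurable_fun setT (fun z : R * R => `|z.2|).
Proof. by apply: measurableT_comp => //; exact: measurable_snd. Qed.

Lemma measurable_box (B : R) : measurable (box B).
Proof.
rewrite /box (_ : [set z | _] =
  [set z : R * R | `|z.1| <= B] `&` [set z | `|z.2| <= B]); last first.
  by apply/seteqP; split => z /= /andP.
by apply: measurableI; apply: measurable_set_le => //;
  [exact: measurable_fst_norm|exact: measurable_snd_norm].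
Qed.

Lemma boxE (B : R) : box B = `[- B, B]%classic `*` `[- B, B]%classic.
Proof.
apply/seteqP; split=> -[u v] /=; rewrite !in_itv/= -!ler_norml => /andP; exact.
Qed.

Lemma box_lty (B : R) : (mu2 (box B) < +oo)%E.
Proof.
rewrite boxE /plane_measure product_measure1E//.
by rewrite lte_mul_pinfty ?mu_itv_lty// ge0_fin_numE// mu_itv_lty.
Qed.

Lemma measurable_riesz_phase (s t : R) (x : R * R) :
  measurable_fun setT (riesz_phase s t x).
Proof.
apply: measurable_funB.
  by apply: measurable_funD => //; exact: measurable_dot.
by apply: measurable_funM => //; exact: measurable_angle.
Qed.

Section Kernel.
Variables (s t : R) (x : R * R) (B : R).
Hypotheses (t0 : 0 < t) (B0 : 0 < B).
Let Phi := riesz_phase s t x.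
Let K : R := 1 + 2 * pi.

Let K0 : 0 < K. Proof. by rewrite ltr_wpDr// mulr_ge0// pi_ge0. Qed.

Let st0 : 0 < Num.sqrt t. Proof. by rewrite sqrtr_gt0. Qed.

(** The absolute convergence that integration along slices requires. *)
Lemma integrable_cos_phase (T : set (R * R)) : measurable T -> T `<=` box B ->
  mu2.-integrable setT (EFin \o (fun z => cos (Phi z) * \1_T z)).
Proof.
move=> mT TB; apply: (@integrable_bounded_supp _ _ _ mu2 _ (box B) 1).
- exact: measurable_box.
- exact: box_lty.
- apply: measurable_funM; last exact: measurable_indic.
  by apply: measurable_cos; exact: measurable_riesz_phase.
- move=> z; rewrite mul1r normrM (ger0_norm (_ : 0 <= \1__ z))//.
  rewrite -[leRHS]mul1r ler_pM// ?cos_max// !indicE ler_nat.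
  by have [/set_mem/TB zB|//] := boolP (z \in T); rewrite mem_set.
Qed.

Let integrable_strip (M : R) : 0 <= M ->
  mu.-integrable setT (EFin \o (fun c => M * \1_(`[- B, B]%classic) c)).
Proof.
move=> M0; apply: (@integrable_bounded_supp _ _ _ mu _ `[- B, B]%classic M) => //.
- exact: mu_itv_lty.
- apply: measurable_funM => //; exact: measurable_indic.
- by move=> y; rewrite ger0_norm// mulr_ge0.
Qed.

Let Rintegral_strip (M : R) : 0 <= M ->
  \int[mu]_c (M * \1_(`[- B, B]%classic) c) = M * (2 * B).
Proof.
move=> M0; rewrite Rintegral_indic//; last exact: mu_itv_lty.
rewrite [X in fine X](lebesgue_measure_itv `[- B, B])/= lte_fin.
have -> : - B < B by rewrite gtrN.
by rewrite -EFinB/=; congr (_ * _); ring.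
Qed.

Let vertical_phase (c y : R) :
  Phi (c, y) = (s + x.1 * c) + x.2 * y - t * (c * inv_norm c y).
Proof. by rewrite /Phi /riesz_phase /dot/= addrA. Qed.

Let horizontal_phase (c y : R) :
  Phi (y, c) = (s + x.2 * c) + x.1 * y - t * (y * inv_norm c y).
Proof.
rewrite /Phi /riesz_phase /dot/= /eucl /inv_norm/= [X in Num.sqrt X]addrC; congr (_ - _).
ring.
Qed.

Let continuous_vertical (c : R) : c != 0 ->
  continuous (fun y => cos ((s + x.1 * c) + x.2 * y - t * (c * inv_norm c y))).
Proof.
move=> c0 y; apply: continuous_comp; last exact: continuous_cos.
apply: cvgB; first apply: cvgD; first exact: cvg_cst.
  by apply: cvgM; [exact: cvg_cst|exact: cvg_id].
apply: cvgM; first exact: cvg_cst.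
by apply: cvgM; [exact: cvg_cst|exact: continuous_inv_norm].
Qed.

Let continuous_horizontal (c : R) : c != 0 ->
  continuous (fun y => cos ((s + x.2 * c) + x.1 * y - t * (y * inv_norm c y))).
Proof.
move=> c0 y; apply: continuous_comp; last exact: continuous_cos.
apply: cvgB; first apply: cvgD; first exact: cvg_cst.
  by apply: cvgM; [exact: cvg_cst|exact: cvg_id].
apply: cvgM; first exact: cvg_cst.
by apply: cvgM; [exact: cvg_id|exact: continuous_inv_norm].
Qed.

Let flat (z : R * R) := (2 * `|z.2| < `|z.1|) && (`|z.1| <= B).
Let steep (z : R * R) := (`|z.1| < `|z.2|) && (`|z.2| <= B).
Let diag (z : R * R) := [&& `|z.2| <= `|z.1|, `|z.1| <= 2 * `|z.2| & `|z.1| <= B].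

Let measurable_flat : measurable [set z | flat z].
Proof.
have -> : [set z | flat z] = [set z : R * R | 2 * `|z.2| < `|z.1| ] `&`
    [set z | `|z.1| <= B].
  by apply/seteqP; split => z /= /andP.
apply: measurableI; [apply: measurable_set_lt|apply: measurable_set_le];
  rewrite ?measurable_fst_norm//; [|exact: measurable_fst_norm..].
by apply: measurable_funM => //; exact: measurable_snd_norm.
Qed.

Let measurable_steep : measurable [set z | steep z].
Proof.
have -> : [set z | steep z] = [set z : R * R | `|z.1| < `|z.2| ] `&`
    [set z | `|z.2| <= B].
  by apply/seteqP; split => z /= /andP.
apply: measurableI; [apply: measurable_set_lt|apply: measurable_set_le] => //;
  by [exact: measurable_fst_norm|exact: measurable_snd_norm].
Qed.

Let measurable_diag : measurable [set z | diag z].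
Proof.
have -> : [set z | diag z] = [set z : R * R | `|z.2| <= `|z.1| ] `&`
    ([set z | `|z.1| <= 2 * `|z.2| ] `&` [set z | `|z.1| <= B]).
  by apply/seteqP; split => z /=; [move=> /and3P[]|move=> [? [? ?]]; apply/and3P].
have := measurable_fst_norm; have := measurable_snd_norm => m2 m1.
apply: measurableI; first exact: measurable_set_le.
apply: measurableI; apply: measurable_set_le => //.
by apply: measurable_funM.
Qed.

Let flat_box : [set z | flat z] `<=` box B.
Proof.
move=> z /andP[]; rewrite /box/= => h1 h2.
by rewrite h2/=; have h3 := normr_ge0 z.2; lra.
Qed.

Let steep_box : [set z | steep z] `<=` box B.
Proof.
move=> z /andP[]; rewrite /box/= => h1 h2.
by rewrite h2 andbT ltW// (lt_le_trans h1).
Qed.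

Let diag_box : [set z | diag z] `<=` box B.
Proof.
move=> z /and3P[]; rewrite /box/= => h1 _ h2.
by rewrite h2 (le_trans h1).
Qed.

Let flat_bound : `|\int[mu2]_z (cos (Phi z) * \1_[set z | flat z] z)| <=
  16 * K * (B ^+ 2 / Num.sqrt t).
Proof.
pose M := K * 8 * (B / Num.sqrt t).
have M0 : 0 <= M by rewrite !mulr_ge0// ?invr_ge0 ltW.
have -> : 16 * K * (B ^+ 2 / Num.sqrt t) = M * (2 * B) by rewrite /M; ring.
rewrite -Rintegral_strip//; apply: normr_fubini1_le.
- exact: integrable_cos_phase.
- exact: integrable_strip.
move=> c /=.
have [cB|cB] := leP `|c| B; last first.
  under eq_Rintegral do rewrite indic_bool /flat/= (leNgt _ B) cB andbF mulr0.
  by rewrite Rintegral_cst// mul0r normr0 mulr_ge0.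
have -> : \1_(`[- B, B]%classic) c = 1 :> R.
  by rewrite indicE mem_set//= in_itv/= -ler_norml.
rewrite mulr1.
have [->|c0] := eqVneq c 0.
  under eq_Rintegral do
    rewrite indic_bool /flat/= normr0 (ltNge _ 0) mulr_ge0//= mulr0.
  by rewrite Rintegral_cst// mul0r normr0.
have n0 : 0 < `|c| by rewrite normr_gt0.
under eq_Rintegral do rewrite vertical_phase indic_bool.
have -> : \int[mu]_y (cos (s + x.1 * c + x.2 * y - t * (c * inv_norm c y)) * (flat (c, y))%:R)
  = \int[mu]_(y in `[- (`|c| / 2), `|c| / 2])
       cos (s + x.1 * c + x.2 * y - t * (c * inv_norm c y)).
  rewrite -(@Rintegral_itv_closed _ _ _ _ false true); last exact: continuous_vertical.
  rewrite -[RHS]Rintegral_mul_indic; apply: eq_Rintegral => y _; congr (_ * _).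
  rewrite indicE; congr (nat_of_bool _)%:R; rewrite /flat/= cB andbT.
  by apply/idP/idP; rewrite inE/= in_itv/= -ltr_norml => h; lra.
apply: le_trans (_ : K * 8 * (`|c| / Num.sqrt t) <= _).
  apply: vertical_slice_flat => //; first by lra.
  by move=> y; rewrite in_itv/= -ler_norml.
by rewrite /M ler_pM2l ?mulr_gt0// ler_pM2r ?invr_gt0.
Qed.

Let diag_bound : `|\int[mu2]_z (cos (Phi z) * \1_[set z | diag z] z)| <=
  36 * K * (B ^+ 2 / Num.sqrt t).
Proof.
pose M := 2 * (K * 9 * (B / Num.sqrt t)).
have M0 : 0 <= M by rewrite !mulr_ge0// ?invr_ge0 ltW.
have -> : 36 * K * (B ^+ 2 / Num.sqrt t) = M * (2 * B) by rewrite /M; ring.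
rewrite -Rintegral_strip//; apply: normr_fubini2_le.
- exact: integrable_cos_phase.
- exact: integrable_strip.
move=> c /=.
have [cB|cB] := leP `|c| B; last first.
  under eq_Rintegral => y _.
    rewrite indic_bool /diag/= (_ : [&& _, _ & _] = false); last first.
      by apply/negP => /and3P[h1 _ h2]; lra.
    rewrite mulr0; over.
  by rewrite Rintegral_cst// mul0r normr0 mulr_ge0.
have -> : \1_(`[- B, B]%classic) c = 1 :> R.
  by rewrite indicE mem_set//= in_itv/= -ler_norml.
rewrite mulr1.
have [->|c0] := eqVneq c 0.
  under eq_Rintegral => y _ do rewrite indic_bool /diag/= normr0 mulr0.
  rewrite (_ : \int[mu]_y _ =
      \int[mu]_y (cos (Phi (y, 0)) * \1_[set 0 : R] y)); last first.
    apply: eq_Rintegral => y _; congr (_ * _); rewrite indicE; congr (nat_of_bool _)%:R.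
    apply/idP/idP; rewrite inE/=; first by rewrite normr_le0 => /and3P[_ /eqP].
    by move=> ->; rewrite normr0 lexx ltW.
  by rewrite Rintegral_mul_indic Rintegral_set1 normr0.
have n0 : 0 < `|c| by rewrite normr_gt0.
under eq_Rintegral do rewrite horizontal_phase.
pose m := Num.min (2 * `|c|) B.
have cm : `|c| <= m by rewrite le_min cB andbT; lra.
have mc : m <= 2 * `|c| by rewrite ge_min lexx.
rewrite (_ : (fun y => _) = (fun y => cos (s + x.2 * c + x.1 * y - t * (y * inv_norm c y))
  * \1_[set y | diag (y, c)] y)); last by apply/funext => y; rewrite !indic_bool.
have KM : K * 9 * (`|c| / Num.sqrt t) <= K * 9 * (B / Num.sqrt t).
  by rewrite ler_pM2l ?mulr_gt0// ler_pM2r ?invr_gt0.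
apply: (@normr_Rintegral_two_itv _ _ _ `|c| m (- m) (- `|c|) _ true false true false).
- exact: continuous_horizontal.
- by move=> y; exact: cos_max.
- move=> y; rewrite !indic_bool !in_itv/= /diag/=.
  have [y0|y0] := ltP 0 y.
    rewrite (gtr0_norm y0) le_min (_ : (y <= - `|c|) = false) ?andbF ?addr0//.
    by apply/negP => h; lra.
  rewrite (ler0_norm y0) (_ : (`|c| <= y) = false) ?add0r; last first.
    by apply/negP => h; lra.
  by rewrite [y <= - _]lerNr [- m <= y]lerNl le_min [in RHS]andbC.
- apply: le_trans _ KM; apply: horizontal_slice_diag => //.
    move=> y; rewrite in_itv/= => /andP[y1 y2].
    by rewrite (@ger0_norm _ y); lra.
  by left => y; rewrite in_itv/= => /andP[y1 y2]; lra.
- apply: le_trans _ KM; apply: horizontal_slice_diag => //.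
  + by rewrite lerN2.
  + move=> y; rewrite in_itv/= => /andP[y1 y2].
    by rewrite (@ler0_norm _ y); lra.
  + by right => y; rewrite in_itv/= => /andP[y1 y2]; lra.
Qed.

Let w (c : R) : R := (Num.sqrt `|c|)^-1.

Let w_ge0 (c : R) : 0 <= w c. Proof. by rewrite invr_ge0 sqrtr_ge0. Qed.

Let measurable_w : measurable_fun setT w.
Proof.
have -> : w = (@powR R ^~ (- 1)) \o (fun c => Num.sqrt `|c|).
  by apply/funext => c /=; rewrite powR_inv1// sqrtr_ge0.
apply: measurableT_comp; first exact: measurable_powR.
apply: measurableT_comp => //.
apply: continuous_measurable_fun; exact: sqrt_continuous.
Qed.

Let continuous_w (c : R) : c != 0 -> {for c, continuous w}.
Proof.
move=> c0; apply: cvgV; first by rewrite gt_eqF// sqrtr_gt0 normr_gt0.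
by apply: (continuous_comp (@norm_continuous _ _ c)); exact: sqrt_continuous.
Qed.

Let int_w (e : R) : 0 < e -> e < B ->
  \int[mu]_(c in `[e, B]) w c = 2 * Num.sqrt B - 2 * Num.sqrt e.
Proof.
move=> e0 eB; rewrite /Rintegral (continuous_FTC2 eB (F := fun c => 2 * Num.sqrt c))//.
- apply: continuous_in_subspaceT => c; rewrite inE/= in_itv/= => /andP[ec _].
  by apply: continuous_w; rewrite gt_eqF// (lt_le_trans e0).
- have cF u : {for u, continuous (fun c : R => 2 * Num.sqrt c)}.
    by apply: cvgM; [exact: cvg_cst|exact: sqrt_continuous].
  split.
  + move=> c; rewrite in_itv/= => /andP[ec _].
    have dc := is_derive1_sqrt (lt_trans e0 ec).
    by apply: derivableM => //; exact: ex_derive.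
  + exact/cvg_at_right_filter/cF.
  + exact/cvg_at_left_filter/cF.
- move=> c; rewrite in_itv/= => /andP[ec _].
  have c0 := lt_trans e0 ec.
  have dc := is_derive1_sqrt c0.
  have dF : is_derive c 1 (fun c : R => 2 * Num.sqrt c) (w c).
    apply: is_derive_eq; rewrite -?[_ *: _]/(_ * _) /w gtr0_norm//.
    by field; rewrite gt_eqF// sqrtr_gt0.
  by rewrite derive1E; apply/derive_val.
Qed.

Let int_wN (e : R) : 0 < e -> e < B ->
  \int[mu]_(c in `[- B, - e]) w c = 2 * Num.sqrt B - 2 * Num.sqrt e.
Proof.
move=> e0 eB; rewrite -int_w// /Rintegral integration_by_substitution_oppr ?ltW//.
  by congr fine; apply: eq_integral => c _ /=; rewrite /w normrN.
apply: continuous_in_subspaceT => c; rewrite inE/= in_itv/= => /andP[_ ec].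
by apply: continuous_w; rewrite lt_eqF//; lra.
Qed.

Let integrable_w (e a b : R) : 0 < e ->
  (forall c, c \in `[a, b] -> e <= `|c|) ->
  mu.-integrable setT (EFin \o (fun c => w c * \1_(`[a, b]%classic) c)).
Proof.
move=> e0 he; apply: (@integrable_bounded_supp _ _ _ mu _ `[a, b]%classic (w e)) => //.
- exact: mu_itv_lty.
- apply: measurable_funM => //; exact: measurable_indic.
- move=> c; rewrite normrM (ger0_norm (_ : 0 <= \1__ c))// !indicE.
  have [/set_mem cab|] := boolP (c \in _); rewrite ?mulr0 // !mulr1.
  have ec := he c cab.
  rewrite ger0_norm// /w lef_pV2 ?posrE ?sqrtr_gt0 ?(lt_le_trans e0 ec)//.
    by rewrite ler_sqrt ?(ltW (lt_le_trans e0 ec))// (gtr0_norm e0).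
  by rewrite (gtr0_norm e0).
Qed.

(** The slice bound is [|c|^{-1/2}] times a constant. It is integrable at [c = 0],
    but not bounded there: the strip [|c| <= e] is estimated trivially, and the
    slice bound is integrated over [e <= |c| <= B]. *)
Let steep_bound : `|\int[mu2]_z (cos (Phi z) * \1_[set z | steep z] z)| <=
  (4 + 48 * K) * (B ^+ 2 / Num.sqrt t).
Proof.
(* With this [e] the strip contributes [4 B e <= 4 B^2 / sqrt t], and [e < B]
   holds for every [t]. *)
pose e := B / (1 + Num.sqrt t).
have e0 : 0 < e by rewrite divr_gt0// addr_gt0.
have eB : e < B by rewrite ltr_pdivrMr ?addr_gt0// ltr_pMr// ltrDl.
pose D := 2 * (K * Num.sqrt (32 * B ^+ 3 / t)).
have D0 : 0 <= D by rewrite !mulr_ge0 ?sqrtr_ge0// ltW.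
pose G c := 2 * B * \1_(`[- e, e]%classic) c +
  D * (w c * \1_(`[e, B]%classic) c + w c * \1_(`[- B, - e]%classic) c).
have i1 : mu.-integrable setT (EFin \o (fun c => w c * \1_(`[e, B]%classic) c)).
  apply: (integrable_w e0) => c; rewrite in_itv/= => /andP[ec _].
  by rewrite (le_trans ec)// ler_norm.
have i2 : mu.-integrable setT (EFin \o (fun c => w c * \1_(`[- B, - e]%classic) c)).
  apply: (integrable_w e0) => c; rewrite in_itv/= => /andP[_ ec].
  by rewrite ler_normr; apply/orP; right; lra.
have i0 : mu.-integrable setT (EFin \o (fun c => 2 * B * \1_(`[- e, e]%classic) c)).
  apply: (@integrable_bounded_supp _ _ _ mu _ `[- e, e]%classic (2 * B)) => //.
  - exact: mu_itv_lty.
  - apply: measurable_funM => //; exact: measurable_indic.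
  - by move=> y; rewrite ger0_norm// !mulr_ge0// ltW.
have i12 : mu.-integrable setT (EFin \o (fun c => w c * \1_(`[e, B]%classic) c
    + w c * \1_(`[- B, - e]%classic) c)).
  exact: integrable_RD.
have i12D : mu.-integrable setT (EFin \o (fun c => D * (w c * \1_(`[e, B]%classic) c
    + w c * \1_(`[- B, - e]%classic) c))).
  exact: integrable_RZ.
have iG : mu.-integrable setT (EFin \o G).
  exact: integrable_RD.
apply: (@le_trans _ _ (\int[mu]_c G c)); last first.
  rewrite /G/= RintegralD//; rewrite [X in _ + X]RintegralZl// RintegralD//.
  rewrite Rintegral_indic; [|by []|exact: mu_itv_lty].
  rewrite !Rintegral_mul_indic int_w// int_wN//.
  rewrite [X in fine X](lebesgue_measure_itv `[- e, e])/= lte_fin.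
  have -> : - e < e by rewrite gtrN.
  rewrite -EFinB/=.
  have h1 : 2 * B * (e - - e) <= 4 * (B ^+ 2 / Num.sqrt t).
    have -> : 2 * B * (e - - e) = 4 * (B * e) by ring.
    rewrite ler_pM2l// expr2 -mulrA ler_pM2l// /e ler_pM2l//.
    by rewrite lef_pV2 ?posrE ?addr_gt0// lerDr.
  have h2 : D * Num.sqrt B <= 12 * K * (B ^+ 2 / Num.sqrt t).
    have -> : D * Num.sqrt B = 2 * K * Num.sqrt ((B ^+ 2) ^+ 2 * 32 / t).
      have e1 : Num.sqrt (32 * B ^+ 3 / t) * Num.sqrt B =
          Num.sqrt ((B ^+ 2) ^+ 2 * 32 / t).
        rewrite -sqrtrM ?divr_ge0 ?mulr_ge0 ?exprn_ge0 ?ltW//.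
        by congr Num.sqrt; ring.
      by rewrite -e1 /D; ring.
    rewrite (@sqrtrM _ ((B ^+ 2) ^+ 2 * 32)); last by rewrite mulr_ge0 ?sqr_ge0.
    rewrite (@sqrtrM _ ((B ^+ 2) ^+ 2)) ?sqr_ge0// (sqrtrV (ltW t0)).
    rewrite sqrtr_sqr ger0_norm ?sqr_ge0//.
    have s32 : Num.sqrt 32 <= 6 :> R.
      by rewrite -(ler_pXn2r (n := 2)) ?nnegrE ?sqrtr_ge0// sqr_sqrtr//; lra.
    have -> : 12 * K * (B ^+ 2 / Num.sqrt t) = 2 * K * (B ^+ 2 * 6 / Num.sqrt t) by ring.
    apply: ler_wpM2l; first by rewrite mulr_ge0// ltW.
    apply: ler_wpM2r; first by rewrite invr_ge0 ltW.
    by apply: ler_wpM2l; first exact: sqr_ge0.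
  have h3 := sqrtr_ge0 e; nra.
apply: normr_fubini1_le => //.
  exact: integrable_cos_phase.
have h1 (y : R) (a b : R) : 0 <= \1_(`[a, b]%classic) y :> R by [].
move=> c /=.
have B20 : 0 <= 2 * B by rewrite mulr_ge0// ltW.
have G0 : 0 <= G c.
  apply: addr_ge0; first exact: mulr_ge0.
  by apply: mulr_ge0 => //; apply: addr_ge0; exact: mulr_ge0.
have [cB|cB] := leP `|c| B; last first.
  under eq_Rintegral => y _.
    rewrite indic_bool /steep/= (_ : _ && _ = false); last first.
      by apply/negP => /andP[? ?]; lra.
    rewrite mulr0; over.
  by rewrite Rintegral_cst// mul0r normr0.
have [ce|ce] := leP `|c| e.
  apply: le_trans (_ : 1 * (B - - B) <= _).
    rewrite (_ : (fun y => _) = (fun y => cos (Phi (c, y)) *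
      \1_[set y | steep (c, y)] y)); last by apply/funext => y; rewrite !indic_bool.
    apply: normr_Rintegral_indic_le.
    - lra.
    - apply: measurable_cos; apply: (measurableT_comp (measurable_riesz_phase s t x)).
      exact: pair1_measurable.
    - by move=> y; exact: cos_max.
    - have -> : [set y | steep (c, y)] = [set y | `|c| < `|y| ] `&` [set y | `|y| <= B].
        by apply/seteqP; split => y /= /andP.
      by apply: measurableI; [apply: measurable_set_lt|apply: measurable_set_le].
    - by move=> y /= /andP[_] /=; rewrite in_itv/= ler_norml.
  have -> : 1 * (B - - B) = 2 * B * 1 by ring.
  have e1 : \1_(`[- e, e]%classic) c = 1 :> R.
    by rewrite indicE mem_set//= in_itv/= -ler_norml.
  rewrite /G e1 lerDl; apply: mulr_ge0 => //.
  by apply: addr_ge0; exact: mulr_ge0.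
have c0 : c != 0 by rewrite -normr_gt0 (lt_trans e0).
have n0 : 0 < `|c| by rewrite normr_gt0.
apply: le_trans (_ : D * w c <= _); last first.
  rewrite /G -mulrDr.
  have -> : \1_(`[e, B]%classic) c + \1_(`[- B, - e]%classic) c = 1 :> R.
    rewrite !indic_bool !in_itv/=.
    have [cp|cn] := ltP 0 c.
      move: cB ce; rewrite gtr0_norm// => -> /ltW ->.
      by rewrite (_ : (c <= - e) = false) ?andbF ?addr0//; apply/negP => h; lra.
    move: cB ce; rewrite ler0_norm// => h1' h2'.
    rewrite (_ : (e <= c) = false) ?add0r; last by apply/negP => h; lra.
    by rewrite (_ : (- B <= c) && _)//; apply/andP; split; lra.
  by rewrite mulr1 lerDr mulr_ge0.
under eq_Rintegral do rewrite vertical_phase.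
rewrite (_ : (fun y => _) = (fun y => cos (s + x.1 * c + x.2 * y - t * (c * inv_norm c y))
  * \1_[set y | steep (c, y)] y)); last by apply/funext => y; rewrite !indic_bool.
have -> : D * w c = 2 * (K * Num.sqrt (32 * B ^+ 3 / t) / Num.sqrt `|c|).
  by rewrite /D /w !mulrA.
apply: (@normr_Rintegral_two_itv _ _ _ `|c| B (- B) (- `|c|) _ false false true true).
- exact: continuous_vertical.
- by move=> y; exact: cos_max.
- move=> y; rewrite !indic_bool !in_itv/= /steep/=.
  have [y0|y0] := ltP 0 y.
    rewrite (gtr0_norm y0) (_ : (y < - `|c|) = false) ?andbF ?addr0//.
    by apply/negP => h; lra.
  rewrite (ler0_norm y0) (_ : (`|c| < y) = false) ?add0r; last first.
    by apply/negP => h; lra.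
  by rewrite [y < - _]ltrNr [- B <= y]lerNl [in RHS]andbC.
- apply: vertical_slice_steep => //.
  move=> y; rewrite in_itv/= => /andP[y1 y2].
  by rewrite (@ger0_norm _ y) ?y1//; lra.
- apply: vertical_slice_steep => //; first by rewrite lerN2.
  move=> y; rewrite in_itv/= => /andP[y1 y2].
  by rewrite (@ler0_norm _ y); lra.
Qed.

(** The box is the disjoint union of the sectors [flat], [steep] and [diag]; the
    contributions [16 K], [4 + 48 K] and [36 K], with [K = 1 + 2 pi], add up to
    [104 + 200 pi]. *)
Lemma normr_box_kernel_le :
  `|\int[mu2]_z (cos (Phi z) * \1_(box B) z)| <=
  (104 + 200 * pi) * (B ^+ 2 / Num.sqrt t).
Proof.
have -> : (fun z => cos (Phi z) * \1_(box B) z) = (fun z =>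
    (cos (Phi z) * \1_[set z | flat z] z + cos (Phi z) * \1_[set z | steep z] z) +
    cos (Phi z) * \1_[set z | diag z] z).
  apply/funext => z; rewrite -!mulrDr; congr (_ * _); rewrite !indic_bool.
  rewrite /flat /steep /diag.
  have [z12|z21] := ltP `|z.1| `|z.2|.
    rewrite (_ : 2 * `|z.2| < `|z.1| = false) ?add0r; last first.
      by apply/negP => h; have := normr_ge0 z.2; lra.
    rewrite andbC /= addr0; case: (leP `|z.2| B) => //= z2B.
    by rewrite ltW// (lt_le_trans z12).
  rewrite addr0/= [_ <= 2 * _]leNgt; case: ltP => _ /=.
    by rewrite addr0; case: (leP `|z.1| B) => //= z1B; rewrite (le_trans z21).
  by rewrite add0r; case: (leP `|z.1| B) => //= z1B; rewrite (le_trans z21).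
have I1 := integrable_cos_phase measurable_flat flat_box.
have I2 := integrable_cos_phase measurable_steep steep_box.
have I3 := integrable_cos_phase measurable_diag diag_box.
rewrite RintegralD//; last first.
  exact: integrable_RD.
rewrite RintegralD//.
apply: le_trans (ler_normD _ _) _.
apply: le_trans (lerD (ler_normD _ _) (lexx _)) _.
apply: le_trans (lerD (lerD flat_bound steep_bound) diag_bound) _.
by rewrite le_eqVlt; apply/orP; left; apply/eqP; rewrite /K; ring.
Qed.

End Kernel.
End BoxKernel.

(** * The Fejer kernel *)

Section Fejer.
Context {R : realType}.
Notation mu := (@lebesgue_measure R).

(** The Fourier transform of the tent of width [1], that is
    [(sin (v / 2) / (v / 2))^2]. *)
Definition fejer (v : R) : R :=
  if v == 0 then 1 else 2 * (1 - cos v) / v ^+ 2.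

Definition tent (N y : R) : R := (1 - `|y| / N) * \1_(`[- N, N]%classic) y.

Lemma measurable_tent (N : R) : measurable_fun setT (tent N).
Proof.
apply: measurable_funM; last exact: measurable_indic.
by apply: measurable_funB => //; apply: measurable_funM.
Qed.

Lemma tent_ge0 (N y : R) : 0 < N -> 0 <= tent N y.
Proof.
move=> N0; rewrite /tent indic_bool in_itv/= -ler_norml.
case: (leP `|y| N) => [yN|_]; rewrite ?mulr0 ?mulr1//.
by rewrite subr_ge0 ler_pdivrMr// mul1r.
Qed.

Lemma tent_le1 (N y : R) : 0 < N -> tent N y <= 1.
Proof.
move=> N0; rewrite /tent indic_bool in_itv/= -ler_norml.
case: (leP `|y| N) => [yN|_]; rewrite ?mulr0 ?mulr1//.
by rewrite gerBl divr_ge0// ltW.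
Qed.

Lemma tent_le_indic (N y : R) : 0 < N -> tent N y <= \1_(`[- N, N]%classic) y.
Proof.
move=> N0; rewrite /tent -[leRHS]mul1r; apply: ler_wpM2r => //.
by rewrite gerBl divr_ge0// ltW.
Qed.

Let continuous_lin (psi v : R) : continuous (fun y : R => psi + v * y).
Proof.
by move=> y; apply: cvgD; [exact: cvg_cst|apply: cvgM; [exact: cvg_cst|exact: cvg_id]].
Qed.

Let continuous_coslin (psi v : R) : continuous (fun y : R => cos (psi + v * y)).
Proof.
move=> y; apply: (continuous_comp (@continuous_lin psi v y)); exact: continuous_cos.
Qed.

Let tent_right (N psi v : R) : 0 < N ->
  \int[mu]_(y in `[0, N]) ((1 - y / N) * cos (psi + v * y)) =
  if v == 0 then cos psi * N / 2 else
  (cos psi - cos (psi + v * N)) / (N * v ^+ 2) - sin psi / v.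
Proof.
move=> N0; have Nn0 : N != 0 by rewrite gt_eqF.
have ab : 0 <= N by exact: ltW.
have cF : continuous (fun y : R => (1 - y / N) * cos (psi + v * y)).
  move=> y; apply: cvgM; last exact: continuous_coslin.
  by apply: cvgB; [exact: cvg_cst|apply: cvgM; [exact: cvg_id|exact: cvg_cst]].
have [v0|v0] := eqVneq v 0.
  have dF (y : R) : is_derive y 1 (fun y => cos psi * (y - y ^+ 2 / (2 * N)))
      ((1 - y / N) * cos (psi + v * y)).
    apply: is_derive_eq; rewrite -?[_ *: _]/(_ * _) v0 mul0r addr0.
    by field.
  by rewrite (Rintegral_derive ab cF dF); field.
have dF (y : R) : is_derive y 1 (fun y => (1 - y / N) * sin (psi + v * y) / v
   - cos (psi + v * y) / (N * v ^+ 2)) ((1 - y / N) * cos (psi + v * y)).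
  have dl : is_derive y 1 (fun y => psi + v * y) v.
    by apply: is_derive_eq; rewrite -?[_ *: _]/(_ * _); ring.
  have ds : is_derive y 1 (fun y => sin (psi + v * y)) (cos (psi + v * y) * v).
    exact: (@is_derive1_comp _ sin (fun y => psi + v * y)).
  have dc : is_derive y 1 (fun y => cos (psi + v * y)) (- sin (psi + v * y) * v).
    exact: (@is_derive1_comp _ cos (fun y => psi + v * y)).
  apply: is_derive_eq; rewrite -?[_ *: _]/(_ * _).
  by field; rewrite Nn0 v0.
rewrite (Rintegral_derive ab cF dF) mulr0 addr0 .
by field; rewrite Nn0 v0.
Qed.

Let tent_left (N psi v : R) : 0 < N ->
  \int[mu]_(y in `[- N, 0]) ((1 + y / N) * cos (psi + v * y)) =
  if v == 0 then cos psi * N / 2 else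
  (cos psi - cos (psi - v * N)) / (N * v ^+ 2) + sin psi / v.
Proof.
move=> N0; have Nn0 : N != 0 by rewrite gt_eqF.
have ab : - N <= 0 by rewrite oppr_le0 ltW.
have cF : continuous (fun y : R => (1 + y / N) * cos (psi + v * y)).
  move=> y; apply: cvgM; last exact: continuous_coslin.
  by apply: cvgD; [exact: cvg_cst|apply: cvgM; [exact: cvg_id|exact: cvg_cst]].
have [v0|v0] := eqVneq v 0.
  have dF (y : R) : is_derive y 1 (fun y => cos psi * (y + y ^+ 2 / (2 * N)))
      ((1 + y / N) * cos (psi + v * y)).
    apply: is_derive_eq; rewrite -?[_ *: _]/(_ * _) v0 mul0r addr0.
    by field.
  by rewrite (Rintegral_derive ab cF dF); field.
have dF (y : R) : is_derive y 1 (fun y => (1 + y / N) * sin (psi + v * y) / v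
   + cos (psi + v * y) / (N * v ^+ 2)) ((1 + y / N) * cos (psi + v * y)).
  have dl : is_derive y 1 (fun y => psi + v * y) v.
    by apply: is_derive_eq; rewrite -?[_ *: _]/(_ * _); ring.
  have ds : is_derive y 1 (fun y => sin (psi + v * y)) (cos (psi + v * y) * v).
    exact: (@is_derive1_comp _ sin (fun y => psi + v * y)).
  have dc : is_derive y 1 (fun y => cos (psi + v * y)) (- sin (psi + v * y) * v).
    exact: (@is_derive1_comp _ cos (fun y => psi + v * y)).
  apply: is_derive_eq; rewrite -?[_ *: _]/(_ * _).
  by field; rewrite Nn0 v0.
rewrite (Rintegral_derive ab cF dF) mulr0 addr0 mulrN.
by field; rewrite Nn0 v0.
Qed.

(** The tent is affine on each half of its support, where [tent_left] and
    [tent_right] give explicit primitives; the terms in [sin psi] cancel. *)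
Lemma Rintegral_tent_cos (N psi v : R) : 0 < N ->
  \int[mu]_y (tent N y * cos (psi + v * y)) = cos psi * (N * fejer (N * v)).
Proof.
move=> N0; have Nn0 : N != 0 by rewrite gt_eqF.
pose h y := (1 - `|y| / N) * cos (psi + v * y).
have ch : continuous h.
  move=> y; apply: cvgM; last exact: continuous_coslin.
  apply: cvgB; first exact: cvg_cst.
  by apply: cvgM; [exact: norm_continuous|exact: cvg_cst].
under eq_Rintegral => y _ do rewrite /tent mulrAC.
rewrite (Rintegral_mul_indic mu `[- N, N]%classic h).
have := @Rintegral_itvB _ h (BLeft (- N)) (BRight N) 0
  (continuous_itv_integrable _ _ ch).
have NN : - N <= 0 by rewrite oppr_le0 ltW.
rewrite !bnd_simp => /(_ NN (ltW N0))/(canRL (subrK _)) ->.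
rewrite (@Rintegral_itv_closed _ h 0 N false false)//.
have -> : \int[mu]_(y in `[0, N]) h y =
    \int[mu]_(y in `[0, N]) ((1 - y / N) * cos (psi + v * y)).
  apply: eq_Rintegral => y; rewrite inE/= in_itv/= => /andP[y0 _].
  by rewrite /h ger0_norm.
have -> : \int[mu]_(y in `[- N, 0]) h y =
    \int[mu]_(y in `[- N, 0]) ((1 + y / N) * cos (psi + v * y)).
  apply: eq_Rintegral => y; rewrite inE/= in_itv/= => /andP[_ y0].
  by rewrite /h ler0_norm// mulNr opprK.
rewrite tent_right// tent_left// /fejer mulf_eq0 (negbTE Nn0)/=.
case: eqVneq => v0; first by field.
by rewrite cosD cosB (mulrC v N); field; rewrite Nn0 v0.
Qed.

Lemma fejer_ge0 (v : R) : 0 <= fejer v.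
Proof.
rewrite /fejer; case: ifP => // _.
by rewrite divr_ge0 ?sqr_ge0// mulr_ge0// subr_ge0 cos_le1.
Qed.

Lemma fejerE (v : R) : fejer v = \int[mu]_y (tent 1 y * cos (v * y)).
Proof.
rewrite -[v in LHS]mul1r -[fejer _]mul1r -[LHS]mul1r -{1}cos0 -Rintegral_tent_cos//.
by apply: eq_Rintegral => y _; rewrite add0r.
Qed.

Lemma integrable_tent_mul (N : R) (h : R -> R) : 0 < N -> measurable_fun setT h ->
  (forall y, `|h y| <= 1) -> mu.-integrable setT (EFin \o (fun y => tent N y * h y)).
Proof.
move=> N0 mh h1; apply: (@integrable_bounded_supp _ _ _ mu _ `[- N, N]%classic 1) => //.
- exact: mu_itv_lty.
- apply: measurable_funM => //; exact: measurable_tent.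
- move=> y; rewrite normrM mulrC; apply: ler_pM => //.
  by rewrite (ger0_norm (tent_ge0 _ N0)) tent_le_indic.
Qed.

Lemma fejer_le1 (v : R) : fejer v <= 1.
Proof.
rewrite [leRHS](_ : 1 = fejer 0); last by rewrite /fejer eqxx.
rewrite !fejerE; apply: le_Rintegral => //.
- apply: integrable_tent_mul => // [|y]; last exact: cos_max.
  by apply: continuous_measurable_fun => y; have := @continuous_coslin 0 v y; under eq_fun do rewrite add0r.
- apply: integrable_tent_mul => // [|y]; last exact: cos_max.
  by apply: continuous_measurable_fun => y; have := @continuous_coslin 0 0 y; under eq_fun do rewrite add0r.
- move=> y _; apply: ler_wpM2l; first exact: tent_ge0.
  by rewrite mul0r cos0 cos_le1.
Qed.

(** Both [fejer v <= 1] and [fejer v * v^2 <= 4] hold, and they add up. *)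
Lemma fejer_le_oneDsqr (v : R) : fejer v <= 8 * (1 + v ^+ 2)^-1.
Proof.
rewrite ler_pdivlMr ?ltr_pwDl ?sqr_ge0//.
have f0 := fejer_ge0 v; have f1 := fejer_le1 v.
have h : fejer v * v ^+ 2 <= 4.
  rewrite /fejer; case: eqVneq => [->|v0]; first by rewrite expr0n/= mulr0.
  by rewrite divfK ?sqrf_eq0//; have := cos_geN1 v; lra.
lra.
Qed.

Lemma measurable_fejer : measurable_fun setT fejer.
Proof.
have -> : fejer = (fun v => \1_[set 0] v +
   2 * (1 - cos v) * (`|v| ^+ 2) `^ (- 1)).
  apply/funext => v; rewrite /fejer indicE powR_inv1 ?sqr_ge0// real_normK ?num_real//.
  rewrite in_set1; case: eqVneq => [->|_]; last by rewrite add0r.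
  by rewrite cos0 subrr mulr0 mul0r addr0.
apply: measurable_funD; first exact: measurable_indic.
apply: measurable_funM.
  apply: measurable_funM => //; apply: measurable_funB => //.
  exact: measurable_cos.
have m : measurable_fun setT ((@powR R ^~ (- 1)) \o (fun v : R => `|v| ^+ 2)).
  by apply: measurableT_comp; [exact: measurable_powR|exact: measurable_funX].
exact: m.
Qed.

Lemma integrable_fejer : mu.-integrable setT (EFin \o fejer).
Proof.
apply: (@le_integrable _ _ _ mu setT measurableT _
  (EFin \o (fun v => 8 * (1 + v ^+ 2)^-1))).
- by apply/measurable_EFinP; exact: measurable_fejer.
- move=> v _ /=; rewrite lee_fin (ger0_norm (fejer_ge0 v)).
  by rewrite (le_trans (fejer_le_oneDsqr v))// ler_norm.
apply: integrable_RZ; apply/integrableP; split.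
  by apply/measurable_EFinP; apply: continuous_measurable_fun; exact: continuous_oneDsqrV.
under eq_integral => v _.
  rewrite gee0_abs/=; last by rewrite lee_fin invr_ge0 addr_ge0// sqr_ge0.
  over.
rewrite (@ge0_symfun_integralT _ (fun v => (1 + v ^+ 2)^-1)).
- rewrite -set_itvcy integral0y_oneDsqr -EFinM ltry//.
- by move=> v; rewrite invr_ge0 addr_ge0// sqr_ge0.
- exact: continuous_oneDsqrV.
- by move=> v /=; rewrite sqrrN.
Qed.

(** The kernel is nonnegative, and positive on [0 < v < 1]. *)
Lemma fejer_mass_gt0 : 0 < \int[mu]_v fejer v.
Proof.
rewrite lt_def Rintegral_ge0 ?andbT//; last by move=> v _; exact: fejer_ge0.
apply/negP => /eqP I0.
have /ae_eq_integral_abs : (\int[mu]_v `|(EFin \o fejer) v| = 0)%E.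
  under eq_integral do rewrite /= ger0_norm ?fejer_ge0//.
  rewrite -[LHS]fineK ?I0//; last exact: integrable_fin_num integrable_fejer.
  by rewrite -/(Rintegral mu setT fejer) I0.
case=> //; first by apply/measurable_EFinP; exact: measurable_fejer.
move=> N [mN N0 sN].
have : (mu (`]0%R, 1%R[%classic : set R) <= mu N)%E.
  apply: le_measure; rewrite ?inE// => v /=; rewrite in_itv/= => /andP[v0 v1].
  apply: sN => /= /(_ I) [] /eqP; rewrite /fejer (gt_eqF v0).
  rewrite !mulf_eq0 pnatr_eq0 /= invr_eq0 sqrf_eq0 (gt_eqF v0) orbF subr_eq0 => /eqP c1.
  have := @cos1sin0 R v; rewrite -c1 normr1 => /(_ erefl) s0.
  have := @sin2_gt0 R v; rewrite s0 ltxx v0/= => h.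
  by have /h : v < 2 by lra.
rewrite N0 [X in (X <= _)%E](lebesgue_measure_itv `]0%R, 1%R[)/= lte_fin ltr01.
by rewrite sube0 lee_fin ler10.
Qed.

End Fejer.

(** * Affine changes of variable *)

Section Affine.
Context {R : realType}.
Notation mu := (@lebesgue_measure R).
Notation mu2 := (@plane_measure R).

Let affine1 (N a y : R) : R := a + y / N.

Let measurable_affine1 (N a : R) : measurable_fun setT (affine1 N a : measurableTypeR R -> measurableTypeR R).
Proof. by apply: measurable_funD => //; apply: measurable_funM. Qed.

Let affine1_preimage (N a x y : R) : 0 < N ->
  affine1 N a @^-1` `]x, y] = `](N * (x - a)), (N * (y - a))]%classic.
Proof.
move=> N0; apply/seteqP; split=> u /=; rewrite !in_itv/= /affine1;
  by rewrite -ltrBlDl -lerBrDl ltr_pdivlMr// ler_pdivrMr// ![_ * N]mulrC.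
Qed.

Lemma lebesgue_affine (N a : R) (A : set R) : 0 < N -> measurable A ->
  (mu (affine1 N a @^-1` A) = N%:E * mu A)%E.
Proof.
move=> N0 mA.
have Ni0 : 0 <= N^-1 by rewrite invr_ge0 ltW.
pose m' : {measure set (measurableTypeR R) -> \bar R} :=
  mscale (NngNum Ni0) (pushforward mu (affine1 N a : measurableTypeR R -> measurableTypeR R)).
pose m := m' (@measurable_affine1 N a).
have mE : forall A, measurable A -> mu A = m A.
  apply: lebesgue_measure_unique => _ [[x y] _ <-].
  rewrite /m /= /mscale/= /pushforward/= affine1_preimage//.
  rewrite [X in X = _](lebesgue_measure_itv `]x, y]).
  rewrite [X in (_ = _ * X)%E](lebesgue_measure_itv `](N * (x - a)), (N * (y - a))])/=.
  rewrite !lte_fin ltr_pM2l// ltrD2r; case: ifP => _; last by rewrite mule0.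
  by rewrite -!EFinB -EFinM; congr EFin; field; rewrite gt_eqF.
rewrite [in RHS]mE// /m/= /mscale/= /pushforward muleA -EFinM divff ?gt_eqF//.
by rewrite mul1e.
Qed.

Definition affine (N : R) (a v : R * R) : R * R := (a.1 + v.1 / N, a.2 + v.2 / N).

Lemma measurable_affine (N : R) (a : R * R) : measurable_fun setT (affine N a).
Proof.
by apply: measurable_fun_pair; apply: measurable_funD => //; apply: measurable_funM.
Qed.

(** Sigma-finite measures on the plane that agree on rectangles are equal. *)
Lemma plane_affine (N : R) (a : R * R) (A : set (R * R)) : 0 < N -> measurable A ->
  (mu2 (affine N a @^-1` A) = (N ^+ 2)%:E * mu2 A)%E.
Proof.
move=> N0 mA.
have N20 : 0 < N ^+ 2 by rewrite exprn_gt0.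
have Ni0 : 0 <= (N ^+ 2)^-1 by rewrite invr_ge0 ltW.
have ma := @measurable_affine N a.
pose m' : {measure set (measurableTypeR R * measurableTypeR R) -> \bar R} :=
  mscale (NngNum Ni0) (pushforward mu2 (affine N a :
   (measurableTypeR R * measurableTypeR R)%type -> (measurableTypeR R * measurableTypeR R)%type)).
pose m := m' ma.
have mE : forall A, measurable A -> (mu \x mu)%E A = m A.
  apply: product_measure_unique => X Y mX mY.
  rewrite /m /= /mscale/= /pushforward/=.
  have -> : affine N a @^-1` (X `*` Y) = (affine1 N a.1 @^-1` X) `*` (affine1 N a.2 @^-1` Y).
    by apply/seteqP; split.
  have mXa : measurable (affine1 N a.1 @^-1` X).
    by rewrite -[X in measurable X]setTI; exact: measurable_affine1.
  have mYa : measurable (affine1 N a.2 @^-1` Y).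
    by rewrite -[X in measurable X]setTI; exact: measurable_affine1.
  rewrite /plane_measure product_measure1E//.
  rewrite [X in (_ * (X * _))%E](lebesgue_affine a.1 N0 mX).
  rewrite [X in (_ * (_ * X))%E](lebesgue_affine a.2 N0 mY).
  rewrite muleACA -EFinM !muleA -EFinM -expr2 mulVf ?gt_eqF//.
  by rewrite mul1e.
rewrite [X in (_ = _ * X)%E]mE// /m/= /mscale/= /pushforward muleA -EFinM divff ?gt_eqF//.
by rewrite mul1e.
Qed.

Lemma ge0_integral_affine (N : R) (a : R * R) (f : R * R -> \bar R) : 0 < N ->
  measurable_fun setT f -> (forall z, (0 <= f z)%E) ->
  (\int[mu2]_v f (affine N a v) = (N ^+ 2)%:E * \int[mu2]_z f z)%E.
Proof.
move=> N0 mf f0.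
have N20 : 0 <= N ^+ 2 by rewrite sqr_ge0.
have ma := @measurable_affine N a.
have e1 := @ge0_integral_pushforward _ _ (measurableTypeR R * measurableTypeR R)%type
  (measurableTypeR R * measurableTypeR R)%type R (affine N a) ma mu2 setT f measurableT mf.
have e2 := @ge0_integral_mscale _ (measurableTypeR R * measurableTypeR R)%type R
  mu2 setT measurableT (NngNum N20) f mf (fun z _ => f0 z).
etransitivity; first by apply: esym; apply: e1 => z _; exact: f0.
etransitivity; last exact: e2.
apply: eq_measure_integral => A mA _; exact: plane_affine.
Qed.

Lemma Rintegral_affine (N : R) (a : R * R) (f : R * R -> R) : 0 < N ->
  mu2.-integrable setT (EFin \o f) ->
  \int[mu2]_v f (affine N a v) = N ^+ 2 * \int[mu2]_z f z.
Proof.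
move=> N0 intf; rewrite /Rintegral.
have mf := measurable_int _ intf.
rewrite integralE [in RHS]integralE.
have -> : (fun v => (f (affine N a v))%:E)^\+%E = (EFin \o f)^\+%E \o affine N a.
  by apply/funext => v; rewrite /= !funeposE.
have -> : (fun v => (f (affine N a v))%:E)^\-%E = (EFin \o f)^\-%E \o affine N a.
  by apply/funext => v; rewrite /= !funenegE.
rewrite !ge0_integral_affine//; [|exact: measurable_funeneg|exact: measurable_funepos].
have /(integrable_pos_fin_num measurableT) Ip := intf.
have /(integrable_neg_fin_num measurableT) In := intf.
rewrite -(fineK Ip) -(fineK In) -!EFinM -!EFinB /=; ring.
Qed.

End Affine.

(** * Fejer means *)

Section Param.
Context d1 d2 (T1 : measurableType d1) (T2 : measurableType d2) {R : realType}.

(** The integral is the difference of those of the positive and the negative parts,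
    to which Tonelli's theorem applies. *)
Lemma measurable_Rintegral_param (m2 : {sigma_finite_measure set T2 -> \bar R})
  (f : T1 * T2 -> R) : measurable_fun setT f ->
  measurable_fun setT (fun x => \int[m2]_y f (x, y)).
Proof.
move=> mf; apply: measurableT_comp; first exact: fine_measurable.
have mEf : measurable_fun setT (EFin \o f) by exact/measurable_EFinP.
have -> : (fun x => (\int[m2]_y (f (x, y))%:E)%E) =
   (fubini_F m2 (EFin \o f)^\+%E \- fubini_F m2 (EFin \o f)^\-%E)%E.
  apply/funext => x; rewrite [LHS]integralE /fubini_F /=.
  by congr (_ - _)%E; apply: eq_integral => y _; rewrite ?funeposE ?funenegE.
apply: emeasurable_funB; apply: measurable_fun_fubini_tonelli_F => //.
- exact: measurable_funepos.
- exact: measurable_funeneg.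
Qed.

End Param.

Section Inversion.
Context {R : realType}.
Notation mu := (@lebesgue_measure R).
Notation mu2 := (@plane_measure R).
Notation mu4 := (mu2 \x mu2)%E.

Definition tent2 (N : R) (y : R * R) : R := tent N y.1 * tent N y.2.
Definition fejer2 (v : R * R) : R := fejer v.1 * fejer v.2.

(** What is asked of a function of the frequency for its Fejer means to converge to
    it: it is bounded, measurable and supported in a box, and it is continuous along
    the sequences [eta + v / (n + 1)] on which the means evaluate it. *)
Record spectral (g : R * R -> R) : Prop := Spectral {
  spectral_measurable : measurable_fun setT g ;
  spectral_supp : exists G b : R, forall xi, `|g xi| <= G * \1_(box b) xi ;
  spectral_cvg : forall eta v, g (affine n.+1%:R eta v) @[n --> \oo] --> g eta }.

Lemma tent2_ge0 (N : R) (y : R * R) : 0 < N -> 0 <= tent2 N y.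
Proof. by move=> N0; rewrite mulr_ge0 ?tent_ge0. Qed.

Lemma tent2_le1 (N : R) (y : R * R) : 0 < N -> tent2 N y <= 1.
Proof. by move=> N0; rewrite mulr_ile1 ?tent_ge0 ?tent_le1. Qed.

Lemma tent2_le_box (N : R) (y : R * R) : 0 < N -> tent2 N y <= \1_(box N) y.
Proof.
move=> N0; have := ler_pM (tent_ge0 y.1 N0) (tent_ge0 y.2 N0) (tent_le_indic y.1 N0) (tent_le_indic y.2 N0).
move/le_trans; apply; rewrite !indic_bool !in_itv/= -!ler_norml.
by case: (`|y.1| <= N); case: (`|y.2| <= N); rewrite ?mulr0 ?mul0r ?mulr1.
Qed.

Lemma measurable_tent2 (N : R) : measurable_fun setT (tent2 N).
Proof.
apply: measurable_funM.
  exact: (measurableT_comp (measurable_tent N) measurable_fst).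
exact: (measurableT_comp (measurable_tent N) measurable_snd).
Qed.

Lemma measurable_fejer2 : measurable_fun setT fejer2.
Proof.
apply: measurable_funM.
  exact: (measurableT_comp measurable_fejer measurable_fst).
exact: (measurableT_comp measurable_fejer measurable_snd).
Qed.

Lemma fejer2_ge0 (v : R * R) : 0 <= fejer2 v.
Proof. by rewrite mulr_ge0 ?fejer_ge0. Qed.

Lemma integrable_fejer2 : mu2.-integrable setT (EFin \o fejer2).
Proof.
have mf : measurable_fun setT (EFin \o fejer2).
  by apply/measurable_EFinP; exact: measurable_fejer2.
apply/(integrable12ltyP mu mu mf) => /=.
have e1 u : (\int[mu]_v `|(fejer2 (u, v))%:E| = (fejer u * \int[mu]_v fejer v)%:E)%E.
  transitivity (\int[mu]_v ((fejer u)%:E * (EFin \o fejer) v))%E.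
    by apply: eq_integral => v _ /=; rewrite ger0_norm ?fejer2_ge0// EFinM.
  rewrite integralZl//; last exact: integrable_fejer.
  by rewrite EFinM fineK//; exact: integrable_fin_num integrable_fejer.
under eq_integral do rewrite e1.
have := integrable_RZ (\int[mu]_v fejer v) (@integrable_fejer R).
move=> /integrableP[_]; apply: le_lt_trans.
rewrite le_eqVlt; apply/orP; left; apply/eqP; apply: eq_integral => u _ /=.
rewrite mulrC ger0_norm// mulr_ge0 ?fejer_ge0//.
by apply: Rintegral_ge0 => ? _; exact: fejer_ge0.
Qed.

Lemma Rintegral_fejer2 : \int[mu2]_v fejer2 v = (\int[mu]_v fejer v) ^+ 2.
Proof.
rewrite (Rfubini1 (m1 := mu) (m2 := mu) integrable_fejer2) /fejer2/=.
under eq_Rintegral => u _ do rewrite RintegralZl ?integrable_fejer//.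
by rewrite RintegralZr ?integrable_fejer.
Qed.

Lemma integrable_tent2_mul (N : R) (h : R * R -> R) : 0 < N ->
  measurable_fun setT h -> (forall y, `|h y| <= 1) ->
  mu2.-integrable setT (EFin \o (fun y => tent2 N y * h y)).
Proof.
move=> N0 mh h1; apply: (@integrable_bounded_supp _ _ _ mu2 _ (box N) 1) => //.
- exact: measurable_box.
- exact: box_lty.
- by apply: measurable_funM => //; exact: measurable_tent2.
- move=> y; rewrite normrM mulrC; apply: ler_pM => //.
  by rewrite (ger0_norm (tent2_ge0 _ N0)) tent2_le_box.
Qed.

Lemma Rintegral_tent2_cos (N psi : R) (w : R * R) : 0 < N ->
  \int[mu2]_y (tent2 N y * cos (psi + dot y w)) =
  cos psi * (N ^+ 2 * fejer2 (N * w.1, N * w.2)).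
Proof.
move=> N0.
have I : mu2.-integrable setT (EFin \o (fun y => tent2 N y * cos (psi + dot y w))).
  apply: integrable_tent2_mul => // [|y]; last exact: cos_max.
  apply: measurable_cos; apply: measurable_funD => //; exact: measurable_dot.
rewrite (Rfubini1 (m1 := mu) (m2 := mu) I) /tent2 /dot/=.
have e1 u : \int[mu]_v (tent N u * tent N v * cos (psi + (u * w.1 + v * w.2))) =
    (N * fejer (N * w.2)) * (tent N u * cos (psi + w.1 * u)).
  under eq_Rintegral => v _ do
    rewrite addrA (mulrC v) (mulrC u) -mulrA.
  rewrite RintegralZl//.
    by rewrite Rintegral_tent_cos//; ring.
  apply: integrable_tent_mul => // [|y]; last exact: cos_max.
  by apply: measurable_cos; apply: measurable_funD => //; apply: measurable_funM.
under eq_Rintegral => u _ do rewrite e1.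
rewrite RintegralZl//.
  by rewrite Rintegral_tent_cos// /fejer2/=; ring.
apply: integrable_tent_mul => // [|y]; last exact: cos_max.
by apply: measurable_cos; apply: measurable_funD => //; apply: measurable_funM.
Qed.

Lemma spectral_integrable (g h : R * R -> R) : spectral g ->
  measurable_fun setT h -> (forall y, `|h y| <= 1) ->
  mu2.-integrable setT (EFin \o (fun y => g y * h y)).
Proof.
move=> [mg [G [b hG]] _] mh h1.
apply: (@integrable_bounded_supp _ _ _ mu2 _ (box b) G) => //.
- exact: measurable_box.
- exact: box_lty.
- exact: measurable_funM.
- move=> y; rewrite normrM -[leRHS]mulr1; exact: ler_pM.
Qed.

Lemma spectral_bounded (g : R * R -> R) : spectral g ->
  exists2 G : R, 0 <= G & forall y, `|g y| <= G.
Proof.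
move=> [_ [G [b hG]] _]; exists `|G| => // y.
rewrite (le_trans (hG y))// (le_trans (ler_norm _))// normrM.
by rewrite -[leRHS]mulr1 ler_wpM2l// !indicE; case: (_ \in _); rewrite ?normr1 ?normr0.
Qed.

(** The mean of [g] around [eta] at scale [1 / N]. The kernel is not normalized, so
    that the means tend to [g eta] times its mass. *)
Definition fejer_mean (N : R) (g : R * R -> R) (eta : R * R) : R :=
  \int[mu2]_v (g (affine N eta v) * fejer2 v).

Lemma integrable_fejer_translate (N : R) (g : R * R -> R) (eta : R * R) : spectral g ->
  mu2.-integrable setT (EFin \o (fun xi =>
    g xi * fejer2 (N * (xi.1 - eta.1), N * (xi.2 - eta.2)))).
Proof.
move=> sg; apply: spectral_integrable => // [|y].
  have m : measurable_fun setT (fun xi : R * R => (N * (xi.1 - eta.1), N * (xi.2 - eta.2))).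
    apply: measurable_fun_pair; apply: measurable_funM => //; apply: measurable_funB => //;
      by [exact: measurable_fst|exact: measurable_snd].
  exact: (measurableT_comp measurable_fejer2 m).
by rewrite ger0_norm ?fejer2_ge0// /fejer2 mulr_ile1 ?fejer_ge0 ?fejer_le1.
Qed.

(** The substitution [xi = eta + v / N]. *)
Lemma fejer_meanE (N : R) (g : R * R -> R) (eta : R * R) : 0 < N -> spectral g ->
  N ^+ 2 * \int[mu2]_xi (g xi * fejer2 (N * (xi.1 - eta.1), N * (xi.2 - eta.2))) =
  fejer_mean N g eta.
Proof.
move=> N0 sg; rewrite /fejer_mean.
rewrite -(Rintegral_affine eta N0 (integrable_fejer_translate N eta sg)).
apply: eq_Rintegral => v _; rewrite /affine/=; congr (_ * fejer2 _).
by case: v => v1 v2 /=; congr (_, _); field; rewrite gt_eqF.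
Qed.

Lemma measurable_affine2 (N : R) :
  measurable_fun setT (fun z : (R * R) * (R * R) => affine N z.1 z.2).
Proof.
have m11 : measurable_fun setT (fun z : (R * R) * (R * R) => z.1.1).
  exact: (measurableT_comp measurable_fst measurable_fst).
have m12 : measurable_fun setT (fun z : (R * R) * (R * R) => z.1.2).
  exact: (measurableT_comp measurable_snd measurable_fst).
have m21 : measurable_fun setT (fun z : (R * R) * (R * R) => z.2.1).
  exact: (measurableT_comp measurable_fst measurable_snd).
have m22 : measurable_fun setT (fun z : (R * R) * (R * R) => z.2.2).
  exact: (measurableT_comp measurable_snd measurable_snd).
by apply: measurable_fun_pair; apply: measurable_funD => //; apply: measurable_funM.
Qed.

Lemma measurable_fejer_mean (N : R) (g : R * R -> R) : spectral g ->
  measurable_fun setT (fejer_mean N g).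
Proof.
move=> sg; apply: (@measurable_Rintegral_param _ _ _ _ _ mu2
  (fun z => g (affine N z.1 z.2) * fejer2 z.2)).
apply: measurable_funM.
  exact: (measurableT_comp (spectral_measurable sg) (measurable_affine2 N)).
exact: (measurableT_comp measurable_fejer2 measurable_snd).
Qed.

Lemma integrable_fejer_mean (N : R) (g : R * R -> R) (eta : R * R) : spectral g ->
  mu2.-integrable setT (EFin \o (fun v => g (affine N eta v) * fejer2 v)).
Proof.
move=> sg; have [G G0 hG] := spectral_bounded sg.
apply: (@le_integrable _ _ _ mu2 setT measurableT _ (EFin \o (fun v => G * fejer2 v))).
- apply/measurable_EFinP; apply: measurable_funM; last exact: measurable_fejer2.
  exact: (measurableT_comp (spectral_measurable sg) (@measurable_affine _ N eta)).
- move=> v _ /=; rewrite lee_fin !normrM (ger0_norm G0) ler_pM//.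
- exact: integrable_RZ integrable_fejer2.
Qed.

Lemma fejer_mean_bounded (N G : R) (g : R * R -> R) (eta : R * R) : spectral g ->
  (forall y, `|g y| <= G) -> `|fejer_mean N g eta| <= G * \int[mu2]_v fejer2 v.
Proof.
move=> sg hG.
apply: le_trans (le_normr_Rintegral measurableT (integrable_fejer_mean N eta sg)) _.
rewrite -RintegralZl//; last exact: integrable_fejer2.
apply: le_Rintegral => //.
- exact: integrable_norm (integrable_fejer_mean N eta sg).
- exact: integrable_RZ integrable_fejer2.
- by move=> v _; rewrite normrM (ger0_norm (fejer2_ge0 _)) ler_wpM2r ?fejer2_ge0.
Qed.

Lemma Rdominated_cvg d (T : measurableType d) (nu : {measure set T -> \bar R})
  (f_ : nat -> T -> R) (f h : T -> R) :
  (forall n, measurable_fun setT (f_ n)) -> measurable_fun setT f ->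
  {ae nu, forall x, f_ n x @[n --> \oo] --> f x} ->
  nu.-integrable setT (EFin \o h) -> (forall n x, `|f_ n x| <= h x) ->
  \int[nu]_x f_ n x @[n --> \oo] --> \int[nu]_x f x.
Proof.
move=> mf_ mf cf ih hh.
have mEf n : measurable_fun setT (EFin \o f_ n) by exact/measurable_EFinP.
have mE : measurable_fun setT (EFin \o f) by exact/measurable_EFinP.
have cE : {ae nu, forall x, setT x -> (EFin \o f_ n) x @[n --> \oo] --> (EFin \o f) x}.
  by apply: filterS cf => x fx _; apply: cvg_EFin fx; apply: nearW.
have bE : {ae nu, forall x n, setT x -> (`|(EFin \o f_ n) x| <= (EFin \o h) x)%E}.
  by apply: aeW => x n _ /=; rewrite lee_fin.
have [If _ cI] := dominated_convergence measurableT mEf mE cE ih bE.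
apply: fine_cvg; rewrite fineK//; exact: integrable_fin_num.
Qed.

End Inversion.

Section Inversion2.
Context {R : realType}.
Notation mu := (@lebesgue_measure R).
Notation mu2 := (@plane_measure R).
Notation mu4 := (mu2 \x mu2)%E.
Notation F2 := (\int[mu2]_v (@fejer2 R) v).

Lemma fejer_mean_cvg (g : R * R -> R) (eta : R * R) : spectral g ->
  fejer_mean n.+1%:R g eta @[n --> \oo] --> g eta * F2.
Proof.
move=> sg; have [G G0 hG] := spectral_bounded sg.
have -> : g eta * F2 = \int[mu2]_v (g eta * fejer2 v).
  by rewrite RintegralZl//; exact: integrable_fejer2.
apply: (@Rdominated_cvg R _ _ mu2 (fun n v => g (affine n.+1%:R eta v) * fejer2 v)
  (fun v => g eta * fejer2 v) (fun v => G * fejer2 v)).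
- move=> n; apply/measurable_EFinP.
  exact: measurable_int (integrable_fejer_mean n.+1%:R eta sg).
- by apply: measurable_funM => //; exact: measurable_fejer2.
- by apply: aeW => v; apply: cvgM; [exact: spectral_cvg|exact: cvg_cst].
- exact: integrable_RZ integrable_fejer2.
- by move=> n v; rewrite normrM (ger0_norm (fejer2_ge0 _)) ler_wpM2r ?fejer2_ge0.
Qed.

(** The Fejer means are bounded uniformly in [N] and [eta], and the box has finite
    measure, so that pointwise convergence passes to the integral. *)
Lemma box_fejer_mean_cvg (g Psi : R * R -> R) (B : R) : spectral g ->
  measurable_fun setT Psi ->
  \int[mu2]_eta (\1_(box B) eta * cos (Psi eta) * fejer_mean n.+1%:R g eta)
    @[n --> \oo] -->
  F2 * \int[mu2]_eta (g eta * (cos (Psi eta) * \1_(box B) eta)).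
Proof.
move=> sg mPsi; have [G G0 hG] := spectral_bounded sg.
have mb := @measurable_indic _ _ R setT (box B) (measurable_box B).
have mc := measurable_cos mPsi.
rewrite -RintegralZl//; last first.
  apply: spectral_integrable => // [|y]; first exact: measurable_funM.
  rewrite normrM mulr_ile1 ?cos_max// indicE; case: (_ \in _); rewrite ?normr1 ?normr0//.
have F20 : 0 <= F2 by apply: Rintegral_ge0 => v _; exact: fejer2_ge0.
apply: (@Rdominated_cvg R _ _ mu2
  (fun n eta => \1_(box B) eta * cos (Psi eta) * fejer_mean n.+1%:R g eta)
  (fun eta => F2 * (g eta * (cos (Psi eta) * \1_(box B) eta)))
  (fun eta => (G * F2) * \1_(box B) eta)).
- move=> n; apply: measurable_funM; last exact: measurable_fejer_mean.
  exact: measurable_funM.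
- apply: measurable_funM => //; apply: measurable_funM.
    exact: spectral_measurable.
  exact: measurable_funM.
- apply: aeW => eta.
  have -> : F2 * (g eta * (cos (Psi eta) * \1_(box B) eta)) =
    \1_(box B) eta * cos (Psi eta) * (g eta * F2) by ring.
  by apply: cvgM; [exact: cvg_cst|exact: fejer_mean_cvg].
- apply: integrable_RZ; apply: integrable_indic_lty; last exact: box_lty.
  exact: measurable_box.
- move=> n eta; rewrite !normrM mulrC.
  apply: ler_pM; rewrite ?mulr_ge0//; first exact: fejer_mean_bounded.
  rewrite -[leRHS]mulr1; apply: ler_pM => //; last exact: cos_max.
  by rewrite ger0_norm.
Qed.

(** With [P] the inverse transform of [g] and [K] the transform of
    [1_box e^{i Psi}], this is the real part of the integral of [P(y) K(- y)] with a tent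
    as a summability factor in [y], written without [P] and [K] so that the order of
    integration can be changed. *)
Definition pairing (N : R) (Psi : R * R -> R) (B : R) (g : R * R -> R) : R :=
  \int[mu2]_y \int[mu2]_eta \int[mu2]_xi (tent2 N y * \1_(box B) eta *
    (g xi * cos (Psi eta + (dot y xi - dot y eta)))).

Lemma boxX_lty (a b : R) : (mu4 (box a `*` box b) < +oo)%E.
Proof.
rewrite (product_measure1E mu2); try exact: measurable_box.
rewrite lte_mul_pinfty//; first by rewrite ge0_fin_numE// box_lty.
exact: box_lty.
Qed.

Lemma indic_setX T1 T2 (A : set T1) (B : set T2) (x : T1) (y : T2) :
  \1_(A `*` B) (x, y) = \1_A x * \1_B y :> R.
Proof.
rewrite !indicE -natrM mulnb; congr (nat_of_bool _)%:R.
apply/idP/idP; rewrite inE/=; first by move=> [? ?]; rewrite !mem_set.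
by move=> /andP[/set_mem ? /set_mem ?].
Qed.

Lemma indic_norm T (A : set T) x : `|\1_A x| = \1_A x :> R.
Proof. by rewrite ger0_norm. Qed.

Lemma indic_le1 T (A : set T) x : \1_A x <= 1 :> R.
Proof. by rewrite indicE; case: (_ \in _). Qed.

Section Fix.
Variables (N : R) (Psi : R * R -> R) (B : R) (g : R * R -> R).
Hypotheses (N0 : 0 < N) (mPsi : measurable_fun setT Psi) (sg : spectral g).

Let U (y eta : R * R) : R :=
  \int[mu2]_xi (g xi * cos (Psi eta + (dot y xi - dot y eta))).

Let mg := spectral_measurable sg.

Let mcosxi y eta :
  measurable_fun setT (fun xi => cos (Psi eta + (dot y xi - dot y eta))).
Proof.
apply: measurable_cos; apply: measurable_funD => //; apply: measurable_funB => //.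
exact: measurable_dot.
Qed.

Let UZ y eta : \int[mu2]_xi (tent2 N y * \1_(box B) eta *
    (g xi * cos (Psi eta + (dot y xi - dot y eta)))) =
    tent2 N y * \1_(box B) eta * U y eta.
Proof.
rewrite RintegralZl//; apply: spectral_integrable => // xi; exact: cos_max.
Qed.

Let measurable_U : measurable_fun setT (fun z : (R * R) * (R * R) => U z.1 z.2).
Proof.
apply: (@measurable_Rintegral_param _ _ _ _ _ mu2
  (fun w : ((R * R) * (R * R)) * (R * R) =>
   g w.2 * cos (Psi w.1.2 + (dot w.1.1 w.2 - dot w.1.1 w.1.2)))).
have m2 : measurable_fun setT (fun w : ((R * R) * (R * R)) * (R * R) => w.2).
  exact: measurable_snd.
have m11 : measurable_fun setT (fun w : ((R * R) * (R * R)) * (R * R) => w.1.1).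
  exact: (measurableT_comp measurable_fst measurable_fst).
have m12 : measurable_fun setT (fun w : ((R * R) * (R * R)) * (R * R) => w.1.2).
  exact: (measurableT_comp measurable_snd measurable_fst).
apply: measurable_funM; first exact: (measurableT_comp mg m2).
apply: measurable_cos; apply: measurable_funD; first exact: (measurableT_comp mPsi m12).
by apply: measurable_funB; exact: measurable_dot.
Qed.

Let normg : R := \int[mu2]_xi `|g xi|.

Let integrable_g : mu2.-integrable setT (EFin \o g).
Proof.
have := @spectral_integrable R g (cst 1) sg.
by under eq_fun do rewrite mulr1; apply => // y; rewrite normr1.
Qed.

Let U_le y eta : `|U y eta| <= normg.
Proof.
have I : mu2.-integrable setT (EFin \o (fun xi =>
    g xi * cos (Psi eta + (dot y xi - dot y eta)))).
  by apply: spectral_integrable => // xi; exact: cos_max.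
apply: le_trans (le_normr_Rintegral measurableT I) _.
apply: le_Rintegral => //; [exact: integrable_norm I|exact: integrable_norm integrable_g|].
by move=> xi _; rewrite normrM -[leRHS]mulr1 ler_pM// cos_max.
Qed.

Let integrable_V : mu4.-integrable setT (EFin \o (fun z =>
  tent2 N z.1 * \1_(box B) z.2 * U z.1 z.2)).
Proof.
apply: (@integrable_bounded_supp _ _ _ mu4 _ (box N `*` box B) normg) => //.
- by apply: measurableX; exact: measurable_box.
- exact: boxX_lty.
- apply: measurable_funM => //; apply: measurable_funM.
    exact: (measurableT_comp (measurable_tent2 N) measurable_fst).
  have mb := @measurable_indic _ _ R setT (box B) (measurable_box B).
  exact: (measurableT_comp mb measurable_snd).
- case=> y eta /=; rewrite indic_setX normrM [leLHS]mulrC.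
  have h0 : 0 <= tent2 N y * \1_(box B) eta by rewrite mulr_ge0// tent2_ge0.
  rewrite (ger0_norm h0); apply: ler_pM => //.
  by rewrite ler_wpM2r// tent2_le_box.
Qed.

Lemma pairing_integrable : mu2.-integrable setT (EFin \o (fun y =>
  \int[mu2]_eta \int[mu2]_xi (tent2 N y * \1_(box B) eta *
    (g xi * cos (Psi eta + (dot y xi - dot y eta)))))).
Proof.
rewrite (_ : _ \o _ = EFin \o (fun y => \int[mu2]_eta
  (tent2 N y * \1_(box B) eta * U y eta))).
  exact: (integrable_Rfubini_F (m1 := mu2) (m2 := mu2) integrable_V).
by apply/funext => y /=; congr EFin; apply: eq_Rintegral => eta _; rewrite UZ.
Qed.

(** Integrated over [y] first, the tent becomes the Fejer kernel at scale [1 / N],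
    evaluated at [xi - eta]; the integral over [xi] is then a Fejer mean of [g]. *)
Lemma pairingE : pairing N Psi B g =
  \int[mu2]_eta (\1_(box B) eta * cos (Psi eta) * fejer_mean N g eta).
Proof.
rewrite /pairing.
under eq_Rintegral => y _ do under eq_Rintegral => eta _ do rewrite UZ.
rewrite (Rfubini (m1 := mu2) (m2 := mu2) integrable_V); apply: eq_Rintegral => eta _ /=.
under eq_Rintegral => y _ do rewrite -UZ.
have I : mu4.-integrable setT (EFin \o (fun z : (R * R) * (R * R) =>
   tent2 N z.1 * \1_(box B) eta *
    (g z.2 * cos (Psi eta + (dot z.1 z.2 - dot z.1 eta))))).
  have [_ [G [b hG]] _] := sg.
  apply: (@integrable_bounded_supp _ _ _ mu4 _ (box N `*` box b) G) => //.
  - by apply: measurableX; exact: measurable_box.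
  - exact: boxX_lty.
  - apply: measurable_funM; first apply: measurable_funM => //.
      exact: (measurableT_comp (measurable_tent2 N) measurable_fst).
    apply: measurable_funM; first exact: (measurableT_comp mg measurable_snd).
    apply: measurable_cos; apply: measurable_funD => //.
    by apply: measurable_funB; apply: measurable_dot.
  - case=> y xi /=; rewrite indic_setX normrM [leRHS]mulrCA.
    have h0 : 0 <= tent2 N y * \1_(box B) eta by rewrite mulr_ge0// tent2_ge0.
    rewrite (ger0_norm h0); apply: ler_pM => //.
      rewrite -[leRHS]mulr1; apply: ler_pM; [exact: tent2_ge0|by []| |].
        exact: tent2_le_box.
      exact: indic_le1.
    by rewrite normrM -[leRHS]mulr1; apply: ler_pM => //; exact: cos_max.
rewrite (Rfubini (m1 := mu2) (m2 := mu2) I) -(fejer_meanE eta N0 sg) /=.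
rewrite mulrA -RintegralZl//; last exact: integrable_fejer_translate.
apply: eq_Rintegral => xi _.
have e1 y : tent2 N y * \1_(box B) eta * (g xi * cos (Psi eta + (dot y xi - dot y eta))) =
  (\1_(box B) eta * g xi) * (tent2 N y * cos (Psi eta + dot y (xi.1 - eta.1, xi.2 - eta.2))).
  have -> : dot y (xi.1 - eta.1, xi.2 - eta.2) = dot y xi - dot y eta.
    by rewrite /dot/=; ring.
  ring.
under eq_Rintegral => y _ do rewrite e1.
rewrite RintegralZl//; last first.
  apply: integrable_tent2_mul => // [|y]; last exact: cos_max.
  by apply: measurable_cos; apply: measurable_funD => //; exact: measurable_dot.
by rewrite Rintegral_tent2_cos//=; ring.
Qed.

End Fix.

End Inversion2.

(** * Inversion against the kernel of a box *)

Section Inversion3.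
Context {R : realType}.
Notation mu := (@lebesgue_measure R).
Notation mu2 := (@plane_measure R).
Notation F2 := (\int[mu2]_v (@fejer2 R) v).

Definition re_synth (g1 g2 : R * R -> R) (y : R * R) : R :=
  \int[mu2]_xi (g1 xi * cos (dot y xi) - g2 xi * sin (dot y xi)).
Definition im_synth (g1 g2 : R * R -> R) (y : R * R) : R :=
  \int[mu2]_xi (g1 xi * sin (dot y xi) + g2 xi * cos (dot y xi)).

Section Fix.
Variables (t : R) (x : R * R) (B : R).
Hypotheses (t0 : 0 < t) (B0 : 0 < B).

Let kernel (s : R) (y : R * R) : R :=
  \int[mu2]_eta (cos (riesz_phase s t (x.1 - y.1, x.2 - y.2) eta) * \1_(box B) eta).

Let phaseB (s : R) (y eta : R * R) :
  riesz_phase s t x eta - dot y eta = riesz_phase s t (x.1 - y.1, x.2 - y.2) eta.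
Proof. by rewrite /riesz_phase /dot/=; ring. Qed.

Let phaseD (s u : R) (y eta : R * R) :
  riesz_phase (s + u) t y eta = riesz_phase s t y eta + u.
Proof. by rewrite /riesz_phase; ring. Qed.

Let mcosdot (y : R * R) : measurable_fun setT (fun xi => cos (dot y xi)).
Proof. by apply: measurable_cos; exact: measurable_dot. Qed.

Let msindot (y : R * R) : measurable_fun setT (fun xi => sin (dot y xi)).
Proof. by apply: measurable_sin; exact: measurable_dot. Qed.

(** For a fixed [y] the integrals over the two frequencies separate, by the addition
    formula for the cosine. *)
Lemma pairing_slice (N s : R) (g : R * R -> R) (y : R * R) : spectral g ->
  \int[mu2]_eta \int[mu2]_xi (tent2 N y * \1_(box B) eta *
    (g xi * cos (riesz_phase s t x eta + (dot y xi - dot y eta)))) =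
  tent2 N y * ((\int[mu2]_xi (g xi * cos (dot y xi))) * kernel s y +
     (\int[mu2]_xi (g xi * sin (dot y xi))) * kernel (s + pi / 2) y).
Proof.
move=> sg.
set a := \int[mu2]_xi (g xi * cos (dot y xi)).
set b := \int[mu2]_xi (g xi * sin (dot y xi)).
have Ic : mu2.-integrable setT (EFin \o (fun xi => g xi * cos (dot y xi))).
  by apply: spectral_integrable => // xi; exact: cos_max.
have Is : mu2.-integrable setT (EFin \o (fun xi => g xi * sin (dot y xi))).
  by apply: spectral_integrable => // xi; exact: sin_max.
pose th s eta := riesz_phase s t (x.1 - y.1, x.2 - y.2) eta.
have Ik s' : mu2.-integrable setT (EFin \o (fun eta => cos (th s' eta) * \1_(box B) eta)).
  by apply: integrable_cos_phase; [exact: measurable_box|exact: subset_refl].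
have inner eta : \int[mu2]_xi (tent2 N y * \1_(box B) eta *
    (g xi * cos (riesz_phase s t x eta + (dot y xi - dot y eta)))) =
    tent2 N y * (a * (cos (th s eta) * \1_(box B) eta) +
      b * (cos (th (s + pi / 2) eta) * \1_(box B) eta)).
  transitivity (\int[mu2]_xi
     (tent2 N y * \1_(box B) eta * cos (th s eta) * (g xi * cos (dot y xi)) +
      tent2 N y * \1_(box B) eta * cos (th (s + pi / 2) eta) * (g xi * sin (dot y xi)))).
    apply: eq_Rintegral => xi _.
    have -> : riesz_phase s t x eta + (dot y xi - dot y eta) = th s eta + dot y xi.
      by rewrite /th -phaseB; ring.
    by rewrite cosD /th phaseD cosDpihalf; ring.
  rewrite RintegralD//; [|exact: integrable_RZ..].
  by rewrite !RintegralZl// -/a -/b; ring.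
under eq_Rintegral => eta _ do rewrite inner.
rewrite RintegralZl//; last by apply: integrable_RD; exact: integrable_RZ.
rewrite RintegralD//; [|exact: integrable_RZ..].
by rewrite !RintegralZl.
Qed.

Variables (g1 g2 : R * R -> R).
Hypotheses (sg1 : spectral g1) (sg2 : spectral g2).

Let synth_mod (y : R * R) : R := Num.sqrt (re_synth g1 g2 y ^+ 2 + im_synth g1 g2 y ^+ 2).

Let kernel_le (s : R) (y : R * R) :
  `|kernel s y| <= (104 + 200 * pi) * (B ^+ 2 / Num.sqrt t).
Proof. exact: normr_box_kernel_le. Qed.

(** The sum over [g1] and [g2] of the separated integrals is the real part of the
    product of the transform of [g1 + i g2] with the kernel: each of its two terms
    is at most the modulus of the transform times the uniform bound of the
    kernel. *)
Lemma pairing_le (N s : R) : 0 < N -> mu2.-integrable setT (EFin \o synth_mod) ->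
  `|pairing N (riesz_phase s t x) B g1 +
    pairing N (riesz_phase (s + pi / 2) t x) B g2| <=
  2 * ((104 + 200 * pi) * (B ^+ 2 / Num.sqrt t)) * \int[mu2]_y synth_mod y.
Proof.
move=> N0 IP; set M := (104 + 200 * pi) * _.
have M0 : 0 <= M by exact: le_trans (normr_ge0 _) (kernel_le 0 0).
have mph s' := measurable_riesz_phase s' t x.
have I1 := pairing_integrable B N0 (mph s) sg1.
have I2 := pairing_integrable B N0 (mph (s + pi / 2)) sg2.
rewrite /pairing -RintegralD; [|exact: measurableT|exact: I1|exact: I2].
apply: le_trans (le_normr_Rintegral measurableT (integrable_RD I1 I2)) _.
rewrite -RintegralZl//.
apply: le_Rintegral => //.
- exact: integrable_norm (integrable_RD I1 I2).
- exact: integrable_RZ.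
move=> y _ /=.
rewrite !pairing_slice// -mulrDr normrM (ger0_norm (tent2_ge0 _ N0)).
set a1 := \int[mu2]_xi (g1 xi * cos _); set b1 := \int[mu2]_xi (g1 xi * sin _).
set a2 := \int[mu2]_xi (g2 xi * cos _); set b2 := \int[mu2]_xi (g2 xi * sin _).
(* Two quarter turns change the sign, so that four products reduce to two. *)
have kN : kernel (s + pi / 2 + pi / 2) y = - kernel s y.
  rewrite /kernel -[RHS]mulN1r -RintegralZl//.
    apply: eq_Rintegral => eta _; rewrite !phaseD -addrA -splitr cosDpi.
    by rewrite mulNr mulN1r.
  by apply: integrable_cos_phase; [exact: measurable_box|exact: subset_refl].
have ReE : re_synth g1 g2 y = a1 - b2.
  by rewrite /re_synth RintegralB//; apply: spectral_integrable => // xi;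
    rewrite ?cos_max ?sin_max.
have ImE : im_synth g1 g2 y = b1 + a2.
  by rewrite /im_synth RintegralD//; apply: spectral_integrable => // xi;
    rewrite ?cos_max ?sin_max.
have -> : a1 * kernel s y + b1 * kernel (s + pi / 2) y +
  (a2 * kernel (s + pi / 2) y + b2 * kernel (s + pi / 2 + pi / 2) y) =
  re_synth g1 g2 y * kernel s y + im_synth g1 g2 y * kernel (s + pi / 2) y.
  by rewrite kN ReE ImE; ring.
have PRe : `|re_synth g1 g2 y| <= synth_mod y.
  by rewrite -sqrtr_sqr ler_sqrt ?addr_ge0 ?sqr_ge0// lerDl sqr_ge0.
have PIm : `|im_synth g1 g2 y| <= synth_mod y.
  by rewrite -sqrtr_sqr ler_sqrt ?addr_ge0 ?sqr_ge0// lerDr sqr_ge0.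
rewrite -[leRHS]mul1r; apply: ler_pM; rewrite ?tent2_ge0 ?tent2_le1//.
apply: le_trans (ler_normD _ _) _; rewrite !normrM.
have -> : 2 * M * synth_mod y = synth_mod y * M + synth_mod y * M by ring.
by apply: lerD; apply: ler_pM.
Qed.

(** The limit of [pairing_le] as the width of the tent tends to infinity: the bound
    does not depend on the width. *)
Lemma inversion_le (s : R) : mu2.-integrable setT (EFin \o synth_mod) ->
  F2 * `|\int[mu2]_eta ((g1 eta * cos (riesz_phase s t x eta) -
     g2 eta * sin (riesz_phase s t x eta)) * \1_(box B) eta)| <=
  2 * ((104 + 200 * pi) * (B ^+ 2 / Num.sqrt t)) * \int[mu2]_y synth_mod y.
Proof.
move=> IP; have mph s' := measurable_riesz_phase s' t x.
have c1 := box_fejer_mean_cvg (B := B) sg1 (mph s).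
have c2 := box_fejer_mean_cvg (B := B) sg2 (mph (s + pi / 2)).
have F20 : 0 <= F2 by apply: Rintegral_ge0 => v _; exact: fejer2_ge0.
have Ik s' g : spectral g -> mu2.-integrable setT (EFin \o (fun eta =>
    g eta * (cos (riesz_phase s' t x eta) * \1_(box B) eta))).
  move=> sg; apply: spectral_integrable => // [|y].
    apply: measurable_funM; first exact: measurable_cos.
    by apply: measurable_indic; exact: measurable_box.
  by rewrite normrM mulr_ile1 ?cos_max// indic_norm indic_le1.
have -> : \int[mu2]_eta ((g1 eta * cos (riesz_phase s t x eta) -
     g2 eta * sin (riesz_phase s t x eta)) * \1_(box B) eta) =
   \int[mu2]_eta (g1 eta * (cos (riesz_phase s t x eta) * \1_(box B) eta)) +
   \int[mu2]_eta (g2 eta * (cos (riesz_phase (s + pi / 2) t x eta) * \1_(box B) eta)).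
  rewrite -RintegralD//; try exact: Ik.
  by apply: eq_Rintegral => eta _; rewrite phaseD cosDpihalf; ring.
rewrite -[X in X * _](ger0_norm F20) -normrM mulrDr.
set L := F2 * _ + F2 * _.
pose u n := `|pairing n.+1%:R (riesz_phase s t x) B g1 +
    pairing n.+1%:R (riesz_phase (s + pi / 2) t x) B g2|.
have cu : u n @[n --> \oo] --> `|L|.
  apply: cvg_norm; apply: cvgD.
    by under eq_fun => n do rewrite (pairingE B (ltr0Sn R n) (mph s) sg1).
  by under eq_fun => n do rewrite (pairingE B (ltr0Sn R n) (mph (s + pi / 2)) sg2).
rewrite -(cvg_lim (@Rhausdorff R) cu).
apply: limr_le; first exact: cvgP cu.
by apply: nearW => n; exact: pairing_le.
Qed.

End Fix.
End Inversion3.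

(** * Topology and measurability of the plane *)

Section Topology.
Context {R : realType}.

Let rbox (p q r : rat) : set (R * R) :=
  [set z | `|z.1 - ratr p| < ratr r] `&` [set z | `|z.2 - ratr q| < ratr r].

Let measurable_rbox (p q r : rat) : measurable (rbox p q r).
Proof.
by apply: measurableI; apply: measurable_set_lt => //;
  apply: (measurableT_comp (@normr_measurable _ setT)) => //;
  apply: measurable_funB.
Qed.

(** The measurable sets of the plane are those of the product of two lines. An open
    set belongs to them as it is the union of the squares with rational centre
    and radius that it contains. *)
Lemma open_plane_measurable (U : set (R * R)) : open U -> measurable U.
Proof.
move=> oU.
have -> : U = \bigcup_p \bigcup_q \bigcup_r
    [set z | rbox p q r z /\ rbox p q r `<=` U].
  apply/seteqP; split=> [z Uz|z [p _ [q _ [r _ [zr]]]]]; last exact.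
  have /nbhs_ballP[e /= e0 he] := open_nbhs_nbhs (conj oU Uz).
  have [r] : exists r : rat, ratr r \in `]0, e / 2[.
    by apply: rat_in_itvoo; rewrite divr_gt0.
  rewrite in_itv/= => /andP[r0 re].
  have [p] : exists p : rat, ratr p \in `]z.1 - ratr r, z.1 + ratr r[.
    by apply: rat_in_itvoo; lra.
  rewrite in_itv/= => /andP[p1 p2].
  have [q] : exists q : rat, ratr q \in `]z.2 - ratr r, z.2 + ratr r[.
    by apply: rat_in_itvoo; lra.
  rewrite in_itv/= => /andP[q1 q2].
  exists p => //; exists q => //; exists r => //; split.
    by split; rewrite /= ltr_norml; apply/andP; split; lra.
  move=> w [/= w1 w2]; apply: he; move: w1 w2; rewrite !ltr_norml.
  move=> /andP[w11 w12] /andP[w21 w22].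
  by split; rewrite /ball/= ltr_norml; apply/andP; split; lra.
apply: bigcupT_measurable_rat => p; apply: bigcupT_measurable_rat => q.
apply: bigcupT_measurable_rat => r.
have [h|h] := pselect (rbox p q r `<=` U).
  rewrite (_ : [set z | _] = rbox p q r); first exact: measurable_rbox.
  by apply/seteqP; split=> [z []|z ?].
rewrite (_ : [set z | _] = set0); first exact: measurable0.
by apply/seteqP; split=> [z []|z].
Qed.

Lemma continuous_plane_measurable (g : R * R -> R) : continuous g ->
  measurable_fun setT g.
Proof.
move=> cg; apply: (measurability _ (RGenOInfty.measurableE R)) => //.
move=> /= _ [_ [a ->] <-]; rewrite setTI; apply: open_plane_measurable.
by apply: open_comp => //; exact: rray_open.
Qed.

Lemma compact_box (b : R) : compact (box b).
Proof.
by rewrite boxE; apply: compact_setX; exact: segment_compact.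
Qed.

Lemma continuous_box_bounded (g : R * R -> R) (b : R) : continuous g ->
  exists G : R, forall z, box b z -> `|g z| <= G.
Proof.
move=> cg.
have /compact_bounded[M [_ hM]] : compact (g @` box b).
  by apply: continuous_compact; [exact: continuous_subspaceT|exact: compact_box].
by exists (M + 1) => z bz; apply: hM; [rewrite ltrDl|exists z].
Qed.

Lemma compact_subset_box (A : set (R * R)) : compact A ->
  exists b : R, A `<=` box b.
Proof.
move=> /compact_bounded[M [_ hM]]; exists (M + 1) => z Az.
have M1 : M < M + 1 by rewrite ltrDl.
have : Num.max `|z.1| `|z.2| <= M + 1 by exact: hM M1 _ Az.
by rewrite ge_max.
Qed.

Let shift_cvg (u w : R) : u + w / n.+1%:R @[n --> \oo] --> u.
Proof.
rewrite -[X in _ --> X]addr0; apply: cvgD; first exact: cvg_cst.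
rewrite -[X in _ --> X](mulr0 w); apply: cvgM; first exact: cvg_cst.
exact: cvg_harmonic.
Qed.

Lemma affine_cvg (eta v : R * R) : affine n.+1%:R eta v @[n --> \oo] --> eta.
Proof.
case: eta => e1 e2; have h1 := @shift_cvg e1 v.1; have h2 := @shift_cvg e2 v.2.
exact: (cvg_pair h1 h2).
Qed.

Lemma dot_affine_cvg (x eta v : R * R) :
  dot x (affine n.+1%:R eta v) @[n --> \oo] --> dot x eta.
Proof.
by apply: cvgD; apply: cvgM; [exact: cvg_cst|exact: shift_cvg|exact: cvg_cst|exact: shift_cvg].
Qed.

End Topology.

(** * The Fourier transform of a test function *)

Local Open Scope complex_scope.

Section Tame.
Context {R : realType}.
Notation mu2 := (@plane_measure R).

(** The properties of [spectral] except for the support: those of the Fourier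
    transform of a test function, which become [spectral] after multiplication by a
    bump. *)
Record tame (h : R * R -> R) : Prop := Tame {
  tame_measurable : measurable_fun setT h ;
  tame_bounded : exists G : R, forall xi, `|h xi| <= G ;
  tame_cvg : forall eta v, h (affine n.+1%:R eta v) @[n --> \oo] --> h eta }.

Lemma spectral_mul (g h : R * R -> R) : spectral g -> tame h ->
  spectral (fun xi => g xi * h xi).
Proof.
move=> [mg [G [b hG]] cg] [mh [H hH] ch]; split.
- exact: measurable_funM.
- exists (G * H), b => xi; rewrite normrM mulrAC; apply: ler_pM => //.
- by move=> eta v; apply: cvgM.
Qed.

Lemma tameD (g h : R * R -> R) : tame g -> tame h -> tame (fun xi => g xi + h xi).
Proof.
move=> [mg [G hG] cg] [mh [H hH] ch]; split.
- exact: measurable_funD.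
- by exists (G + H) => xi; rewrite (le_trans (ler_normD _ _))// lerD.
- by move=> eta v; apply: cvgD.
Qed.

Lemma tameZ (k : R) (h : R * R -> R) : tame h -> tame (fun xi => k * h xi).
Proof.
move=> [mh [H hH] ch]; split.
- exact: measurable_funM.
- by exists (`|k| * H) => xi; rewrite normrM ler_wpM2l.
- by move=> eta v; apply: cvgM; [exact: cvg_cst|].
Qed.

Lemma continuous_spectral (g : R * R -> R) (b : R) : continuous g ->
  (forall xi, g xi != 0 -> box b xi) -> spectral g.
Proof.
move=> cg hb; have [G hG] := continuous_box_bounded b cg.
split; first exact: continuous_plane_measurable.
- exists G, b => xi; rewrite indicE.
  have [/set_mem h|/negP h] := boolP (xi \in _); first by rewrite mulr1 hG.
  rewrite mulr0; have [->|/hb h'] := eqVneq (g xi) 0; first by rewrite normr0.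
  by exfalso; apply: h; rewrite inE.
- by move=> eta v; apply: (continuous_cvg _ (cg eta)); exact: affine_cvg.
Qed.

(** The transform is bounded by the integral of [|h|], and it is continuous by
    dominated convergence. *)
Lemma tame_transform (h : R * R -> R) (e : R -> R) : spectral h -> continuous e ->
  (forall u, `|e u| <= 1) -> tame (fun xi => \int[mu2]_x (h x * e (dot x xi))).
Proof.
move=> sh ce e1; have [G G0 hG] := spectral_bounded sh.
have me : measurable_fun setT e by exact: continuous_measurable_fun.
have mh := spectral_measurable sh.
have md (xi : R * R) : measurable_fun setT (fun x => e (dot x xi)).
  by apply: (measurableT_comp me); exact: measurable_dot.
have I xi : mu2.-integrable setT (EFin \o (fun x => h x * e (dot x xi))).
  exact: spectral_integrable.
have Ih : mu2.-integrable setT (EFin \o h).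
  have := @spectral_integrable R h (cst 1) sh.
  by under eq_fun do rewrite mulr1; apply => // y; rewrite normr1.
have he xi x : `|h x * e (dot x xi)| <= `|h x|.
  by rewrite normrM -[leRHS]mulr1 ler_pM.
split.
- apply: (@measurable_Rintegral_param _ _ _ _ _ mu2
    (fun z : (R * R) * (R * R) => h z.2 * e (dot z.2 z.1))).
  apply: measurable_funM; first exact: (measurableT_comp mh measurable_snd).
  apply: (measurableT_comp me); apply: measurable_dot.
    exact: measurable_snd.
  exact: measurable_fst.
- exists (\int[mu2]_x `|h x|) => xi.
  apply: le_trans (le_normr_Rintegral measurableT (I xi)) _.
  by apply: le_Rintegral => //; exact: integrable_norm.
- move=> eta v; apply: (@Rdominated_cvg R _ _ mu2
    (fun n x => h x * e (dot x (affine n.+1%:R eta v)))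
    (fun x => h x * e (dot x eta)) (fun x => `|h x|)) => //.
  + by move=> n; apply: measurable_funM => //; exact: md.
  + by apply: measurable_funM => //; exact: md.
  + apply: aeW => x; apply: cvgM; first exact: cvg_cst.
    by apply: (continuous_cvg _ (ce _)); exact: dot_affine_cvg.
  + exact: integrable_norm.
Qed.

End Tame.

Section Fourier.
Context {R : realType}.
Notation mu2 := (@plane_measure R).

Lemma Re_real_mul (r : R) (z : R[i]) : complex.Re (r%:C * z) = r * complex.Re z.
Proof. by case: z => a b /=; rewrite mul0r subr0. Qed.

Lemma Im_real_mul (r : R) (z : R[i]) : complex.Im (r%:C * z) = r * complex.Im z.
Proof. by case: z => a b /=; rewrite mul0r addr0. Qed.

Lemma Re_mul_expi (z : R[i]) (u : R) : complex.Re (z * expi u) =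
  complex.Re z * cos u - complex.Im z * sin u.
Proof. by case: z. Qed.

Lemma Im_mul_expi (z : R[i]) (u : R) : complex.Im (z * expi u) =
  complex.Re z * sin u + complex.Im z * cos u.
Proof. by case: z. Qed.

Lemma expiD (u v : R) : expi (u + v) = expi u * expi v.
Proof. by rewrite /expi cosD sinD [sin u * _ + _]addrC. Qed.

Lemma test_function_spectral (f : R * R -> R[i]) : test_function f ->
  spectral (fun x => complex.Re (f x)) /\ spectral (fun x => complex.Im (f x)).
Proof.
move=> [sr si cf]; have [b hb] := compact_subset_box cf.
have h x : f x != 0 -> box b x by move=> fx; apply: hb; exact: subset_closure.
split; apply: (continuous_spectral (b := b)).
- exact: (sr 0%N).
- by move=> x fx; apply: h; apply: contra_neq fx => ->.
- exact: (si 0%N).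
- by move=> x fx; apply: h; apply: contra_neq fx => ->.
Qed.

(** The real and imaginary parts are linear combinations of cosine and sine
    transforms of real functions. *)
Lemma fourier_tame (f : R * R -> R[i]) : test_function f ->
  tame (fun xi => complex.Re (fourier f xi)) /\
  tame (fun xi => complex.Im (fourier f xi)).
Proof.
move=> /test_function_spectral[sr si].
pose kap : R := ((2 * pi) ^+ 2)^-1.
have tc h : spectral h -> tame (fun xi => \int[mu2]_x (h x * cos (dot x xi))).
  by move=> sh; apply: tame_transform => //; [exact: continuous_cos|exact: cos_max].
have ts h : spectral h -> tame (fun xi => \int[mu2]_x (h x * sin (dot x xi))).
  by move=> sh; apply: tame_transform => //; [exact: continuous_sin|exact: sin_max].
have Ic h xi : spectral h -> mu2.-integrable setT (EFin \o (fun x => h x * cos (dot x xi))).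
  move=> sh; apply: spectral_integrable => // [|u]; last exact: cos_max.
  by apply: measurable_cos; exact: measurable_dot.
have Is h xi : spectral h -> mu2.-integrable setT (EFin \o (fun x => h x * sin (dot x xi))).
  move=> sh; apply: spectral_integrable => // [|u]; last exact: sin_max.
  by apply: measurable_sin; exact: measurable_dot.
split.
- have -> : (fun xi => complex.Re (fourier f xi)) = (fun xi => kap *
    (\int[mu2]_x (complex.Re (f x) * cos (dot x xi)) +
     \int[mu2]_x (complex.Im (f x) * sin (dot x xi)))).
    apply/funext => xi; rewrite /fourier Re_real_mul /=; congr (_ * _).
    rewrite -RintegralD//; [|exact: Ic|exact: Is].
    by apply: eq_Rintegral => x _; rewrite Re_mul_expi cosN sinN mulrN opprK.
  by apply: tameZ; apply: tameD; [exact: tc|exact: ts].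
- have -> : (fun xi => complex.Im (fourier f xi)) = (fun xi => kap *
    (\int[mu2]_x (complex.Im (f x) * cos (dot x xi)) +
     (-1) * \int[mu2]_x (complex.Re (f x) * sin (dot x xi)))).
    apply/funext => xi; rewrite /fourier Im_real_mul /=; congr (_ * _).
    rewrite -RintegralZl//; last exact: Is.
    rewrite -RintegralD//; [|exact: Ic|apply: integrable_RZ; exact: Is].
    by apply: eq_Rintegral => x _; rewrite Im_mul_expi cosN sinN; ring.
  by apply: tameZ; apply: tameD; [exact: tc|apply: tameZ; exact: ts].
Qed.

(** The link between the complex definition of [P_j f] and the real transforms in
    which [inversion_le] is stated. *)
Lemma LPproj_modulus (phi : R * R -> R) (j : int) (f : R * R -> R[i]) (y : R * R) :
  let g1 xi := phi (2 ^ (- j) *: xi) * complex.Re (fourier f xi) in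
  let g2 xi := phi (2 ^ (- j) *: xi) * complex.Im (fourier f xi) in
  modulus (LPproj phi j f y) =
  Num.sqrt (re_synth g1 g2 y ^+ 2 + im_synth g1 g2 y ^+ 2).
Proof.
move=> g1 g2.
have hR : complex.Re (LPproj phi j f y) = re_synth g1 g2 y.
  transitivity (\int[mu2]_xi complex.Re ((phi (2 ^ (- j) *: xi))%:C * fourier f xi
    * expi (dot y xi))); first by [].
  by apply: eq_Rintegral => xi _; rewrite Re_mul_expi Re_real_mul Im_real_mul.
have hI : complex.Im (LPproj phi j f y) = im_synth g1 g2 y.
  transitivity (\int[mu2]_xi complex.Im ((phi (2 ^ (- j) *: xi))%:C * fourier f xi
    * expi (dot y xi))); first by [].
  by apply: eq_Rintegral => xi _; rewrite Im_mul_expi Re_real_mul Im_real_mul.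
by rewrite /modulus hR hI.
Qed.

Lemma dilate_spectral (phi : R * R -> R) (b : R) (k : R) : 0 < k -> continuous phi ->
  (forall xi, phi xi != 0 -> box b xi) -> spectral (fun xi => phi (k *: xi)).
Proof.
move=> k0 cphi hb; apply: (continuous_spectral (b := b / k)).
  move=> xi; apply: (@continuous_comp _ _ _ (fun xi : R * R => k *: xi) phi).
    exact: scaler_continuous.
  exact: cphi.
move=> xi /hb; rewrite /box/= -![_ *: _]/(_ * _) !normrM (gtr0_norm k0).
by rewrite !ler_pdivlMr// ![_ * k]mulrC.
Qed.

End Fourier.

(** * Summation over frequency shells *)

Section Final.
Context {R : realType}.
Notation mu := (@lebesgue_measure R).
Notation mu2 := (@plane_measure R).
Notation F2 := (\int[mu2]_v (@fejer2 R) v).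

(** If the positive or the negative part has an infinite integral, the difference
    of the two is infinite, and the finite part of an infinite value is [0]. *)
Lemma Rintegral_not_integrable d (T : measurableType d) (nu : {measure set T -> \bar R})
  (f : T -> R) : measurable_fun setT f -> ~ nu.-integrable setT (EFin \o f) ->
  \int[nu]_x f x = 0.
Proof.
move=> mf; have mE : measurable_fun setT (EFin \o f) by exact/measurable_EFinP.
move=> ni; rewrite /Rintegral integralE.
have p0 : (0%:E <= \int[nu]_x (EFin \o f)^\+ x)%E by apply: integral_ge0.
have q0 : (0%:E <= \int[nu]_x (EFin \o f)^\- x)%E by apply: integral_ge0.
have : ~ (\int[nu]_x (EFin \o f)^\+ x + \int[nu]_x (EFin \o f)^\- x < +oo)%E.
  apply: contra_not ni => h; apply/integrableP; split => //.
  rewrite -ge0_integralD// in h; last 2 first.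
  - exact: measurable_funepos.
  - exact: measurable_funeneg.
  by under eq_integral => x _ do rewrite -[X in `|X|%E]/((EFin \o f) x) -/((abse \o (EFin \o f)) x) fune_abse.
move: p0 q0; rewrite -/(funepos (EFin \o f)).
case: (\int[nu]_x (EFin \o f)^\+ x)%E => [p| |]; case: (\int[nu]_x (EFin \o f)^\- x)%E => [q| |] //=.
by move=> _ _ h; exfalso; apply: h; rewrite -EFinD ltry.
Qed.

Lemma integrable_Rsum d (T : measurableType d) (nu : {measure set T -> \bar R})
  (I : Type) (s : seq I) (h : I -> T -> R) :
  (forall i, nu.-integrable setT (EFin \o h i)) ->
  nu.-integrable setT (EFin \o (fun x => \sum_(i <- s) h i x)).
Proof.
move=> ih; elim: s => [|i s IH].
  under eq_fun do rewrite big_nil; exact: integrable0.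
by under eq_fun do rewrite big_cons; exact: integrable_RD.
Qed.

Lemma normr_Rintegral_sum_le d (T : measurableType d) (nu : {measure set T -> \bar R})
  (I : Type) (s : seq I) (h : I -> T -> R) :
  (forall i, nu.-integrable setT (EFin \o h i)) ->
  `|\int[nu]_x \sum_(i <- s) h i x| <= \sum_(i <- s) `|\int[nu]_x h i x|.
Proof.
move=> ih; elim: s => [|i s IH].
  under eq_Rintegral do rewrite big_nil.
  by rewrite Rintegral_cst// mul0r big_nil normr0.
under eq_Rintegral do rewrite big_cons.
rewrite RintegralD//; last exact: integrable_Rsum.
by rewrite big_cons (le_trans (ler_normD _ _))// lerD.
Qed.

Lemma plane_neq0 : {ae mu2, forall xi : R * R, xi != 0}.
Proof.
exists [set (0 : R * R)]; split.
- have -> : [set (0 : R * R)] = [set (0 : R)] `*` [set (0 : R)].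
    by apply/seteqP; split=> [z ->//|[u v] /= [-> ->]].
  by apply: measurableX; exact: measurable_set1.
- have -> : [set (0 : R * R)] = [set (0 : R)] `*` [set (0 : R)].
    by apply/seteqP; split=> [z ->//|[u v] /= [-> ->]].
  rewrite /plane_measure product_measure1E ?measurable_set1//.
  by rewrite [X in (X * _)%E]lebesgue_measure_set1 mul0e.
- by move=> xi /= /negP; rewrite negbK => /eqP.
Qed.

(** The indicator of [1 / (n + 1) < max(|xi_1|, |xi_2|) <= n + 1], written as a
    difference of boxes because the estimates are on boxes. *)
Let shell (n : nat) (xi : R * R) : R :=
  \1_(box n.+1%:R) xi - \1_(box n.+1%:R^-1) xi.

Let shell_cvg (xi : R * R) : xi != 0 -> shell n xi @[n --> \oo] --> (1 : R).
Proof.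
move=> xi0; apply: cvg_near_cst.
have [u [u0 hu]] : exists u : R, 0 < u /\ forall r, box r xi -> u <= r.
  have [x1|x1] := eqVneq xi.1 0.
    exists `|xi.2|; split; last by move=> r /andP[].
    rewrite normr_gt0; apply: contra_neq xi0 => x2.
    by rewrite [xi]surjective_pairing x1 x2.
  by exists `|xi.1|; split; [rewrite normr_gt0|move=> r /andP[]].
near=> n.
rewrite /shell !indicE mem_set; last first.
  rewrite /box/=; apply/andP; split.
    apply: (@le_trans _ _ n%:R); last by rewrite ler_nat.
    by near: n; exact: nbhs_infty_ger.
  apply: (@le_trans _ _ n%:R); last by rewrite ler_nat.
  by near: n; exact: nbhs_infty_ger.
rewrite memNset ?subr0// => /hu.
apply/negP; rewrite -ltNge invf_plt ?posrE//.
apply: (@lt_le_trans _ _ n%:R); last by rewrite ler_nat.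
by near: n; exact: nbhs_infty_gtr.
Unshelve. all: by end_near. Qed.

Let shell_bound n xi : `|shell n xi| <= 1.
Proof.
rewrite /shell !indicE; case: (_ \in _); case: (_ \in _) => /=;
  by rewrite ?subrr ?subr0 ?sub0r ?normrN ?normr1 ?normr0.
Qed.

Let measurable_shell n : measurable_fun setT (shell n).
Proof.
by apply: measurable_funB; apply: measurable_indic; exact: measurable_box.
Qed.

Lemma eucl_ge1 (xi : R * R) : `|xi.1| <= eucl xi.
Proof. by rewrite -sqrtr_sqr ler_sqrt ?addr_ge0 ?sqr_ge0// lerDl sqr_ge0. Qed.

Lemma eucl_ge2 (xi : R * R) : `|xi.2| <= eucl xi.
Proof. by rewrite -sqrtr_sqr ler_sqrt ?addr_ge0 ?sqr_ge0// lerDr sqr_ge0. Qed.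

Lemma eucl_le (xi : R * R) : eucl xi <= `|xi.1| + `|xi.2|.
Proof.
rewrite -(ler_pXn2r (n := 2)) ?nnegrE ?sqrtr_ge0 ?addr_ge0//.
rewrite sqr_sqrtr ?addr_ge0 ?sqr_ge0// sqrrD !real_normK ?num_real//.
by rewrite lerD2r lerDl mulrn_wge0// mulr_ge0.
Qed.

Lemma euclZ (k : R) (xi : R * R) : 0 <= k -> eucl (k *: xi) = k * eucl xi.
Proof.
move=> k0; rewrite /eucl -![(_ *: _).1]/(_ * _) -![(_ *: _).2]/(_ * _).
by rewrite !exprMn -mulrDr sqrtrM ?sqr_ge0// sqrtr_sqr ger0_norm.
Qed.

Lemma finite_int_norm_lt (J : nat) : finite_set [set j : int | (`|j| < J)%N].
Proof.
(* The shift by [J] maps the integers of this set into [0, ..., 2 J - 1]. *)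
apply: (@sub_finite_set _ _ ((fun k : nat => k%:Z - J%:Z)%R @` `I_(J + J))).
  move=> j /= jJ; exists (absz (j + J%:Z)); first by rewrite /=; lia.
  lia.
exact/finite_image/finite_II.
Qed.

Lemma int_norm_ge (j : int) (J : nat) : ~ (`|j| < J)%N -> j < J%:Z -> J%:Z <= - j.
Proof. move=> h1 h2; lia. Qed.

Variables (phi : R * R -> R) (hphi : littlewood_paley_bump phi).

Let phi_continuous : continuous phi.
Proof. by have [sphi _ _] := hphi; exact: (sphi 0%N). Qed.

Lemma bump_annulus : exists a b : R, [/\ 0 < a, 0 < b &
  forall xi, phi xi != 0 -> a <= eucl xi <= b].
Proof.
have [_ [a [b [a0 hab]]] _] := hphi; exists a, (Num.max a b); split=> //.
  by rewrite lt_max a0.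
by move=> xi /hab /andP[-> h]; rewrite /= le_max h orbT.
Qed.

(** On a shell the size of [xi] lies between two positive bounds, so that
    [phi (2^{-j} xi)] vanishes once [|j|] is large, uniformly on the shell; the sum
    defining the partition of unity reduces to a finite one. *)
Lemma shell_partition (n : nat) : exists2 A : set int, finite_set A & forall xi,
  shell n xi = (\sum_(j <- finmap.enum_fset (fset_set A)) phi (2 ^ (- j) *: xi)) * shell n xi.
Proof.
have [a [b [a0 b0 hab]]] := bump_annulus.
have [_ _ hsum] := hphi.
(* For [2^J > Y] the annulus of every [j >= J] lies beyond the shell and that of
   every [j <= - J] within the hole of the shell. *)
pose Y := Num.max (2 * n.+1%:R / a) (b * n.+1%:R).
pose J := Num.bound Y.
have YJ : Y < 2 ^+ J by exact: upper_nthrootP.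
have fA := finite_int_norm_lt J.
exists [set j : int | (`|j| < J)%N] => // xi.
have [s0|s0] := eqVneq (shell n xi) 0; first by rewrite s0 mulr0.
have n0 : (0 : R) < n.+1%:R by rewrite ltr0n.
have [b1 b2] : box n.+1%:R xi /\ ~ box n.+1%:R^-1 xi.
  move: s0; rewrite /shell !indicE.
  have [/set_mem h1|h1] := boolP (xi \in box n.+1%:R);
    have [h2|h2] := boolP (xi \in box n.+1%:R^-1); rewrite ?subrr ?eqxx//.
    by move=> _; split=> //; apply/negP; move: h2; apply: contra; rewrite inE.
  exfalso; move/negP: h1; apply; rewrite inE; move: h2 => /set_mem /andP[h2 h3].
  have nn : n.+1%:R^-1 <= n.+1%:R :> R.
    by rewrite (@le_trans _ _ 1)// ?invf_le1 ?ler1n.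
  by rewrite /box/= (le_trans h2)// (le_trans h3).
have xi0 : xi != 0.
  apply: contra_not_neq b2 => ->; rewrite /box/= normr0.
  by rewrite !invr_ge0 ltW.
rewrite -[LHS]mul1r; congr (_ * _); rewrite -[LHS](hsum xi xi0).
rewrite -(fsbig_widen [set j : int | (`|j| < J)%N]); last 2 first.
- by [].
- move=> j /= [_ jJ]; apply/eqP; apply: contraT => /hab.
  rewrite euclZ; last by rewrite exprz_ge0.
  move=> /andP[ha hb]; exfalso.
  have e1 : eucl xi <= 2 * n.+1%:R.
    move: b1 => /andP[h1 h2]; apply: le_trans (eucl_le xi) _.
    by rewrite mulr_natl mulr2n lerD.
  have e2 : n.+1%:R^-1 < eucl xi.
    rewrite ltNge; apply/negP => h; apply: b2.
    by rewrite /box/= (le_trans (eucl_ge1 _) h) (le_trans (eucl_ge2 _) h).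
  have Y1 : 2 * n.+1%:R / a < 2 ^+ J by apply: le_lt_trans YJ; rewrite le_max lexx.
  have Y2 : b * n.+1%:R < 2 ^+ J by apply: le_lt_trans YJ; rewrite le_max lexx orbT.
  have p2 (i : int) : 0 < (2 : R) ^ i by rewrite exprz_gt0.
  have [jpos|jneg] := leP (J%:Z) j.
    have J1 : (2 : R) ^+ J <= 2 ^ j.
      by rewrite -[X in X <= _]/(2 ^ J%:Z); apply: ler_weXz2l => //; rewrite ler1n.
    move: ha; rewrite -invr_expz.
    have := p2 j; set w := 2 ^ j => w0 ha.
    have : a * w <= eucl xi by rewrite mulrC -ler_pdivlMl.
    have : 2 * n.+1%:R < a * w.
      rewrite ltr_pdivrMr// in Y1; apply: lt_le_trans Y1 _.
      by rewrite mulrC ler_pM2l.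
    by move=> h1 h2; have := lt_le_trans h1 (le_trans h2 e1); rewrite ltxx.
  have J2 : (2 : R) ^+ J <= 2 ^ (- j).
    rewrite -[X in X <= _]/(2 ^ J%:Z); apply: ler_weXz2l; [by rewrite ler1n|].
    exact: int_norm_ge.
  have h1 : b * n.+1%:R < 2 ^ (- j) by exact: lt_le_trans Y2 J2.
  have h2 : 2 ^ (- j) / n.+1%:R < b.
    apply: lt_le_trans hb; by rewrite ltr_pM2l.
  by move: h2; rewrite ltr_pdivrMr// => h2; have := lt_trans h1 h2; rewrite ltxx.
by rewrite fsbig_finite.
Qed.

Let F2_gt0 : 0 < F2.
Proof. by rewrite Rintegral_fejer2 exprn_gt0// fejer_mass_gt0. Qed.

Variable f : R * R -> R[i].
Hypothesis hf : test_function f.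

Let g1 (j : int) xi := phi (2 ^ (- j) *: xi) * complex.Re (fourier f xi).
Let g2 (j : int) xi := phi (2 ^ (- j) *: xi) * complex.Im (fourier f xi).

Variables (a b : R) (b0 : 0 < b).
Hypothesis hab : forall xi, phi xi != 0 -> a <= eucl xi <= b.

Let p2 (j : int) : (0 : R) < 2 ^ j. Proof. by rewrite exprz_gt0. Qed.

Let dilate_supp (j : int) xi : phi (2 ^ (- j) *: xi) != 0 -> box (b * 2 ^ j) xi.
Proof.
move=> /hab; rewrite euclZ ?(ltW (p2 _))// -invr_expz ler_pdivrMl// => /andP[_].
rewrite mulrC => h; rewrite /box/=.
by rewrite (le_trans (eucl_ge1 xi))//= (le_trans (eucl_ge2 xi)).
Qed.

Let spectral_phij (j : int) : spectral (fun xi => phi (2 ^ (- j) *: xi)).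
Proof.
apply: (dilate_spectral (b := b)) => // xi /hab/andP[_ h].
by rewrite /box/= (le_trans (eucl_ge1 xi))//= (le_trans (eucl_ge2 xi)).
Qed.

Let spectral_g1 j : spectral (g1 j).
Proof. by apply: spectral_mul => //; have [] := fourier_tame hf. Qed.

Let spectral_g2 j : spectral (g2 j).
Proof. by apply: spectral_mul => //; have [] := fourier_tame hf. Qed.

Let LPmod (j : int) (y : R * R) : R :=
  Num.sqrt (re_synth (g1 j) (g2 j) y ^+ 2 + im_synth (g1 j) (g2 j) y ^+ 2).

Let measurable_LPmod j : measurable_fun setT (LPmod j).
Proof.
have m1 := spectral_measurable (spectral_g1 j).
have m2 := spectral_measurable (spectral_g2 j).
have md : measurable_fun setT (fun z : (R * R) * (R * R) => dot z.1 z.2).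
  by apply: measurable_dot; [exact: measurable_fst|exact: measurable_snd].
have mc := measurable_cos md.
have ms := measurable_sin md.
have m1' := measurableT_comp m1 (@measurable_snd _ _ (R * R)%type (R * R)%type).
have m2' := measurableT_comp m2 (@measurable_snd _ _ (R * R)%type (R * R)%type).
have mS : measurable_fun setT (@Num.sqrt R).
  by apply: continuous_measurable_fun; exact: sqrt_continuous.
apply: (measurableT_comp mS); apply: measurable_funD; apply: measurable_funX.
- apply: (@measurable_Rintegral_param _ _ _ _ _ mu2
    (fun z : (R * R) * (R * R) => g1 j z.2 * cos (dot z.1 z.2) - g2 j z.2 * sin (dot z.1 z.2))).
  by apply: measurable_funB; apply: measurable_funM.
- apply: (@measurable_Rintegral_param _ _ _ _ _ mu2
    (fun z : (R * R) * (R * R) => g1 j z.2 * sin (dot z.1 z.2) + g2 j z.2 * cos (dot z.1 z.2))).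
  by apply: measurable_funD; apply: measurable_funM.
Qed.

Let const_gt0 : (0 : R) < 104 + 200 * pi.
Proof.
apply: ltr_pwDl; first exact: ltr0n.
by apply: mulr_ge0; [exact: ler0n|exact: pi_ge0].
Qed.

(** The constant of [inversion_le] at [B = b 2^j], without the factor
    [2^{2j} / sqrt t]. *)
Let decay_const : R := 2 * (104 + 200 * pi) * b ^+ 2 / F2.

Let decay_const_gt0 : 0 < decay_const.
Proof.
apply: divr_gt0; last exact: F2_gt0.
apply: mulr_gt0; last exact: exprn_gt0.
by apply: mulr_gt0; [exact: ltr0n|exact: const_gt0].
Qed.

Variables (t : R) (t0 : 0 < t).

Let besov_term (j : int) : \bar R :=
  ((2 ^ (2 * j))%:E * cLnorm 1 (LPproj phi j f))%E.

Let besov_term_ge0 j : (0%:E <= besov_term j)%E.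
Proof. by apply: mule_ge0; [rewrite lee_fin ltW|exact: Lnorm_ge0]. Qed.

(** The [L^1] norm of [P_j f] may be infinite, hence an extended integral. *)
Let cLnorm1E j : cLnorm 1 (LPproj phi j f) = (\int[mu2]_y (LPmod j y)%:E)%E.
Proof.
rewrite /cLnorm Lnorm1; apply: eq_integral => y _.
by rewrite LPproj_modulus /= ger0_norm ?sqrtr_ge0.
Qed.

Let Phi s x := riesz_phase s t x.

(** The bound of [inversion_le] grows with [B^2], but the integrand is supported in
    the box of size [b 2^j]; so the box can be assumed no larger than that, and
    [B^2] is at most [b^2 2^{2j}]. *)
Let box_term (s : R) (x : R * R) (j : int) (B : R) : 0 < B ->
  (`|\int[mu2]_xi ((g1 j xi * cos (Phi s x xi) - g2 j xi * sin (Phi s x xi))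
      * \1_(box B) xi)|%:E <= (decay_const / Num.sqrt t)%:E * besov_term j)%E.
Proof.
move=> B0; have st0 : 0 < Num.sqrt t by rewrite sqrtr_gt0.
have ct0 : 0 < decay_const / Num.sqrt t by rewrite divr_gt0.
rewrite /besov_term cLnorm1E.
(* If [P_j f] is not integrable, the right-hand side is infinite. *)
have [IP|nIP] := pselect (mu2.-integrable setT (EFin \o LPmod j)); last first.
  have -> : (\int[mu2]_y (LPmod j y)%:E = +oo)%E.
    apply/eqP; rewrite eq_le leey/= leNgt; apply/negP => h; apply: nIP.
    apply/integrableP; split; first by apply/measurable_EFinP; exact: measurable_LPmod.
    by under eq_integral => y _ do rewrite /= ger0_norm ?sqrtr_ge0//.
  by rewrite gt0_muley ?lte_fin// gt0_muley ?lte_fin// leey.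
(* The smaller box contains the part of the larger one where the piece lives. *)
pose B' := Num.min B (b * 2 ^ j).
have B'0 : 0 < B' by rewrite lt_min B0 mulr_gt0.
have -> : \int[mu2]_xi ((g1 j xi * cos (Phi s x xi) - g2 j xi * sin (Phi s x xi))
      * \1_(box B) xi) =
  \int[mu2]_xi ((g1 j xi * cos (Phi s x xi) - g2 j xi * sin (Phi s x xi))
      * \1_(box B') xi).
  apply: eq_Rintegral => xi _; rewrite /g1 /g2.
  have [->|/dilate_supp/andP[h1 h2]] := eqVneq (phi (2 ^ (- j) *: xi)) 0.
    by rewrite !mul0r subrr !mul0r.
  congr (_ * _); rewrite !indic_bool; congr (nat_of_bool _)%:R.
  by rewrite !le_min h1 h2 !andbT.
have := inversion_le x t0 B'0 (spectral_g1 j) (spectral_g2 j) s IP.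
set I := `| _ |; rewrite -/(Rintegral mu2 setT (LPmod j)) => hI.
have IPE : (\int[mu2]_y (LPmod j y)%:E = (\int[mu2]_y LPmod j y)%:E)%E.
  by rewrite fineK//; exact: integrable_fin_num IP.
rewrite IPE -!EFinM lee_fin.
have P0 : 0 <= \int[mu2]_y LPmod j y by apply: Rintegral_ge0 => y _; exact: sqrtr_ge0.
have IF : I <= 2 * ((104 + 200 * pi) * (B' ^+ 2 / Num.sqrt t)) * (\int[mu2]_y LPmod j y) / F2.
  by rewrite ler_pdivlMr// mulrC.
apply: le_trans IF _.
have -> : decay_const / Num.sqrt t * (2 ^ (2 * j) * \int[mu2]_y LPmod j y) =
  2 * ((104 + 200 * pi) * ((b * 2 ^ j) ^+ 2 / Num.sqrt t)) * (\int[mu2]_y LPmod j y) / F2.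
  have -> : (2 : R) ^ (2 * j) = (2 ^ j) ^+ 2.
    by rewrite -[RHS]/((2 ^ j) ^ 2%:Z) exprz_exp mulrC.
  by rewrite /decay_const; ring.
have pi0 := ltW const_gt0.
apply: ler_wpM2r; first by rewrite invr_ge0 ltW.
apply: ler_wpM2r => //; apply: ler_wpM2l => //; apply: ler_wpM2l => //.
apply: ler_wpM2r; first by rewrite invr_ge0 ltW.
apply: lerXn2r; last by rewrite ge_min lexx orbT.
  by rewrite nnegrE ltW.
by rewrite nnegrE; apply: mulr_ge0; exact: ltW.
Qed.

Let fh1 xi := complex.Re (fourier f xi).
Let fh2 xi := complex.Im (fourier f xi).

Let integrable_box_term (s : R) (x : R * R) (j : int) (B : R) :
  mu2.-integrable setT (EFin \o (fun xi =>
    (g1 j xi * cos (Phi s x xi) - g2 j xi * sin (Phi s x xi)) * \1_(box B) xi)).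
Proof.
have mb := @measurable_indic _ _ R setT (box B) (measurable_box B).
have mc := measurable_cos (measurable_riesz_phase s t x).
have ms := measurable_sin (measurable_riesz_phase s t x).
have Ic : mu2.-integrable setT (EFin \o (fun xi =>
    g1 j xi * (cos (Phi s x xi) * \1_(box B) xi))).
  apply: spectral_integrable; [exact: spectral_g1|exact: measurable_funM|].
  by move=> xi; rewrite normrM indic_norm mulr_ile1 ?cos_max// indic_le1.
have Is : mu2.-integrable setT (EFin \o (fun xi =>
    g2 j xi * (sin (Phi s x xi) * \1_(box B) xi))).
  apply: spectral_integrable; [exact: spectral_g2|exact: measurable_funM|].
  by move=> xi; rewrite normrM indic_norm mulr_ile1 ?sin_max// indic_le1.
have := integrable_RD Ic (integrable_RZ (-1) Is).
apply: eq_integrable => // xi _ /=; congr EFin; ring.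
Qed.

Let shell_term (s : R) (x : R * R) (n : nat) (j : int) :
  (`|\int[mu2]_xi ((g1 j xi * cos (Phi s x xi) - g2 j xi * sin (Phi s x xi))
      * shell n xi)|%:E <= (2 * (decay_const / Num.sqrt t))%:E * besov_term j)%E.
Proof.
have -> : \int[mu2]_xi ((g1 j xi * cos (Phi s x xi) - g2 j xi * sin (Phi s x xi))
      * shell n xi) =
  \int[mu2]_xi ((g1 j xi * cos (Phi s x xi) - g2 j xi * sin (Phi s x xi))
      * \1_(box n.+1%:R) xi) -
  \int[mu2]_xi ((g1 j xi * cos (Phi s x xi) - g2 j xi * sin (Phi s x xi))
      * \1_(box n.+1%:R^-1) xi).
  rewrite -RintegralB; [|exact: measurableT|exact: integrable_box_term..].
  by apply: eq_Rintegral => xi _; rewrite /shell mulrBr.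
apply: (@le_trans _ _ ((decay_const / Num.sqrt t)%:E * besov_term j +
  (decay_const / Num.sqrt t)%:E * besov_term j)%E); last first.
  have ct0 : (0%:E <= (decay_const / Num.sqrt t)%:E)%E.
    by rewrite lee_fin; apply: divr_ge0; [exact: ltW decay_const_gt0|exact: sqrtr_ge0].
  rewrite -(ge0_muleDl _ ct0 ct0) -EFinD.
  by rewrite (_ : decay_const / Num.sqrt t + _ = 2 * (decay_const / Num.sqrt t))//; ring.
apply: le_trans (_ : _ <= (`|_| + `|_|)%:E)%E _.
  by rewrite lee_fin; exact: ler_normB.
by rewrite EFinD; apply: leeD; apply: box_term; rewrite ?invr_gt0 ltr0n.
Qed.

Let besov_partial_le (A : set int) : finite_set A ->
  (\sum_(j <- finmap.enum_fset (fset_set A)) besov_term j <= besov_2_1_1 phi f)%E.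
Proof.
move=> fA; apply: ereal_sup_ubound; exists A; first by split.
by rewrite fsbig_finite.
Qed.

(** On each shell the integral is bounded through a partial sum of the Besov norm,
    hence through the norm itself; this no longer depends on the shell and passes
    to the limit. *)
Lemma oscillatory_integral_le (s : R) (x : R * R) :
  (`|\int[mu2]_xi (fh1 xi * cos (Phi s x xi) - fh2 xi * sin (Phi s x xi))|%:E
    <= (2 * (decay_const / Num.sqrt t))%:E * besov_2_1_1 phi f)%E.
Proof.
pose F xi := fh1 xi * cos (Phi s x xi) - fh2 xi * sin (Phi s x xi).
have st0 : 0 < Num.sqrt t by rewrite sqrtr_gt0.
have ct0 : 0 < 2 * (decay_const / Num.sqrt t).
  by apply: mulr_gt0; [exact: ltr0n|apply: divr_gt0; [exact: decay_const_gt0|]].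
have mF : measurable_fun setT F.
  have [t1 t2] := fourier_tame hf.
  apply: measurable_funB; apply: measurable_funM.
  - exact: tame_measurable t1.
  - exact: measurable_cos (measurable_riesz_phase s t x).
  - exact: tame_measurable t2.
  - exact: measurable_sin (measurable_riesz_phase s t x).
have bn0 : (0%:E <= besov_2_1_1 phi f)%E by apply: esum_ge0 => j _; exact: besov_term_ge0.
have [IF|nIF] := pselect (mu2.-integrable setT (EFin \o F)); last first.
  have F0 : \int[mu2]_xi F xi = 0 by apply: Rintegral_not_integrable; [exact: mF|exact: nIF].
  by rewrite [Rintegral _ _ _]F0 normr0 mule_ge0// lee_fin ltW.
have bound n : (`|\int[mu2]_xi (F xi * shell n xi)|%:E <=
    (2 * (decay_const / Num.sqrt t))%:E * besov_2_1_1 phi f)%E.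
  have [A fA hA] := shell_partition n.
  pose h (j : int) xi := (g1 j xi * cos (Phi s x xi) - g2 j xi * sin (Phi s x xi))
      * shell n xi.
  have Ih j : mu2.-integrable setT (EFin \o h j).
    have := integrable_RD (integrable_box_term s x j n.+1%:R)
      (integrable_RZ (-1) (integrable_box_term s x j n.+1%:R^-1)).
    apply: eq_integrable => // xi _ /=; congr EFin; rewrite /h /shell; ring.
  have -> : \int[mu2]_xi (F xi * shell n xi) =
      \int[mu2]_xi \sum_(j <- finmap.enum_fset (fset_set A)) h j xi.
    apply: eq_Rintegral => xi _; rewrite hA mulr_suml mulr_sumr.
    by apply: eq_bigr => j _; rewrite /h /F /g1 /g2 -/(fh1 xi) -/(fh2 xi); ring.
  apply: (@le_trans _ _ (\sum_(j <- finmap.enum_fset (fset_set A))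
      `|\int[mu2]_xi h j xi|)%:E).
    by rewrite lee_fin; exact: normr_Rintegral_sum_le.
  apply: (@le_trans _ _ ((2 * (decay_const / Num.sqrt t))%:E *
      \sum_(j <- finmap.enum_fset (fset_set A)) besov_term j)%E); last first.
    by apply: lee_wpmul2l; [rewrite lee_fin ltW|exact: besov_partial_le].
  rewrite ge0_sume_distrr; last by move=> j _; exact: besov_term_ge0.
  by rewrite -sumEFin; apply: lee_sum => j _; exact: shell_term.
have cF : \int[mu2]_xi (F xi * shell n xi) @[n --> \oo] --> \int[mu2]_xi F xi.
  apply: (@Rdominated_cvg R _ _ mu2 (fun n xi => F xi * shell n xi) F
    (fun xi => `|F xi|)).
  - by move=> n; apply: measurable_funM => //; exact: measurable_shell.
  - exact: mF.
  - have [N [mN N0 sN]] := plane_neq0; exists N; split=> // xi; apply: contra_notP.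
    move=> xiN /=; have xi0 : xi != 0 by apply: contra_notT xiN => h0; apply: sN => /=; exact/negP.
    rewrite -[X in _ --> X]mulr1.
    by apply: cvgM; [exact: cvg_cst|exact: shell_cvg].
  - exact: integrable_norm.
  - move=> n xi; rewrite normrM -[leRHS]mulr1 ler_wpM2l//; exact: shell_bound.
move: bound; case: (besov_2_1_1 phi f) bn0 => [r| |] //= _ bound; last first.
  by rewrite gt0_muley ?lte_fin// leey.
have cn : `|\int[mu2]_xi (F xi * shell n xi)| @[n --> \oo] -->
    `|\int[mu2]_xi F xi| by exact: cvg_norm cF.
rewrite -EFinM lee_fin -(cvg_lim (@Rhausdorff R) cn).
apply: limr_le; first exact: cvgP cn.
by apply: nearW => n; have := bound n; rewrite -EFinM lee_fin.
Qed.

Let expi_sandwich (u v : R) (z : R[i]) : expi u * z * expi v = z * expi (v + u).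
Proof. by rewrite expiD; ring. Qed.

(** The real part is the oscillatory integral at [s = 0] and the imaginary part the
    one at [s = - pi / 2]. *)
Lemma riesz_semigroup_modulus_le (x : R * R) :
  ((modulus (riesz_semigroup t f x))%:E <=
    (4 * (decay_const / Num.sqrt t))%:E * besov_2_1_1 phi f)%E.
Proof.
have Re_E : complex.Re (riesz_semigroup t f x) =
    \int[mu2]_xi (fh1 xi * cos (Phi 0 x xi) - fh2 xi * sin (Phi 0 x xi)).
  transitivity (\int[mu2]_xi complex.Re (expi (- (t * (xi.1 / eucl xi))) *
    fourier f xi * expi (dot x xi))); first by [].
  apply: eq_Rintegral => xi _.
  rewrite expi_sandwich Re_mul_expi /Phi /riesz_phase add0r.
  by [].
have Im_E : complex.Im (riesz_semigroup t f x) =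
    \int[mu2]_xi (fh1 xi * cos (Phi (- (pi / 2)) x xi) -
      fh2 xi * sin (Phi (- (pi / 2)) x xi)).
  transitivity (\int[mu2]_xi complex.Im (expi (- (t * (xi.1 / eucl xi))) *
    fourier f xi * expi (dot x xi))); first by [].
  apply: eq_Rintegral => xi _.
  rewrite expi_sandwich Im_mul_expi.
  have -> : Phi (- (pi / 2)) x xi = dot x xi + - (t * (xi.1 / eucl xi)) - pi / 2.
    by rewrite /Phi /riesz_phase; ring.
  by rewrite cosBpihalf sinBpihalf mulrN opprK.
have := oscillatory_integral_le 0 x; rewrite -Re_E.
have := oscillatory_integral_le (- (pi / 2)) x; rewrite -Im_E => h1 h2.
apply: (@le_trans _ _ (`|complex.Re (riesz_semigroup t f x)| +
  `|complex.Im (riesz_semigroup t f x)|)%:E).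
  rewrite lee_fin; set z := riesz_semigroup t f x.
  exact: (eucl_le (complex.Re z, complex.Im z)).
rewrite EFinD; apply: le_trans (leeD h2 h1) _.
have ct0 : (0%:E <= (2 * (decay_const / Num.sqrt t))%:E)%E.
  rewrite lee_fin; apply: mulr_ge0; first exact: ler0n.
  by apply: divr_ge0; [exact: ltW decay_const_gt0|exact: sqrtr_ge0].
rewrite -(ge0_muleDl _ ct0 ct0) -EFinD.
by rewrite (_ : 2 * (decay_const / Num.sqrt t) + _ = 4 * (decay_const / Num.sqrt t))//; ring.
Qed.

End Final.

Theorem proposition2p1 (R : realType) (phi : R * R -> R)
    (hphi : littlewood_paley_bump phi) :
  exists C : R, 0 < C /\
    forall f : R * R -> R[i], test_function f ->
    forall t : R, 0 < t ->
      (cLnorm +oo (riesz_semigroup t f)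
         <= (C * t `^ (- 2^-1))%:E * besov_2_1_1 phi f)%E.
Proof.
have [a [b [a0 b0 hab]]] := bump_annulus hphi.
exists (4 * (2 * (104 + 200 * pi) * b ^+ 2 / \int[@plane_measure R]_v fejer2 v)).
split.
  apply: mulr_gt0; first exact: ltr0n.
  apply: divr_gt0; last by rewrite Rintegral_fejer2; apply: exprn_gt0; exact: fejer_mass_gt0.
  apply: mulr_gt0; last exact: exprn_gt0.
  apply: mulr_gt0; first exact: ltr0n.
  apply: ltr_pwDl; first exact: ltr0n.
  by apply: mulr_ge0; [exact: ler0n|exact: pi_ge0].
move=> f hf t t0.
rewrite powRN powR12_sqrt ?(ltW t0)// -mulrA /cLnorm unlock.
have h := riesz_semigroup_modulus_le hphi hf b0 hab t0.
(* The [L^oo] norm is an essential supremum, or [0] if the space has measure [0]. *)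
case: ifP => _; last first.
  by apply: le_trans (h 0); rewrite lee_fin sqrtr_ge0.
apply/ess_supP; apply: aeW => x /=; rewrite ger0_norm ?sqrtr_ge0//; exact: h.
Qed.
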